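(* Let $N\in\mathcal{LC}$ and let $M\in\mathcal{N}_{\preceq,R}$ (Roumieu case), respectively $M\in\mathcal{N}_{\preceq,B}$ (Beurling case), be such that $(M,N)_{SV}$ holds true. Then for any $\mathbf{a}\in\Lambda_{\{M\}}$ (respectively any $\mathbf{a}\in\Lambda_{(M)}$) there exist infinitely many functions in $\mathcal{D}_{\{N\}}([-1,1])$ (respectively in $\mathcal{D}_{(N)}([-1,1])$) which are mapped onto $\mathbf{a}$ by $\mathcal{B}$. In fact, these functions can be taken to form an infinite-dimensional affine vector space of dimension $\mathfrak{c}$ (the cardinality of the continuum).
   Context: $\mathbb{N}=\{0,1,2,\dots\}$, $\mathbb{N}_{>0}=\{1,2,\dots\}$. $\mathcal{LC}$ is the set of sequences $N\in\mathbb{R}_{>0}^{\mathbb{N}}$ that are normalized ($1=N_0\le N_1$), log-convex ($N_j^2\le N_{j-1}N_{j+1}$ for $j\ge1$) and satisfy $\lim_{j\to\infty}(N_j)^{1/j}=+\infty$. Put $\nu_j:=N_j/N_{j-1}$ for $j\ge1$, $\nu_0:=1$. $M\preceq N$ means $\sup_{j\ge1}(M_j/N_j)^{1/j}<+\infty$. For the fixed $N$: $\mathcal{N}_{\preceq,R}:=\{M\in\mathbb{R}_{>0}^{\mathbb{N}}:\liminf_{p\to\infty}(M_p/p!)^{1/p}>0,\ M\preceq N\}$ and $\mathcal{N}_{\preceq,B}:=\{M\in\mathbb{R}_{>0}^{\mathbb{N}}:\lim_{p\to\infty}(M_p/p!)^{1/p}=+\infty,\ M\preceq N\}$. Condition $(M,N)_{SV}$: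 there exists $s\in\mathbb{N}_{>0}$ with $\sup_{p\ge1}\frac{\lambda^{M,N}_{p,s}}{p}\sum_{k\ge p}\frac1{\nu_k}<+\infty$, where $\lambda^{M,N}_{p,s}:=\sup_{0\le j<p}\left(\frac{M_p}{s^pN_j}\right)^{1/(p-j)}$. For $M\in\mathbb{R}_{>0}^{\mathbb{N}}$, $h>0$: $\Lambda_{M,h}:=\{(a_p)_p\in\mathbb{C}^{\mathbb{N}}:\sup_p |a_p|/(h^pM_p)<+\infty\}$, $\Lambda_{\{M\}}:=\bigcup_{h>0}\Lambda_{M,h}$, $\Lambda_{(M)}:=\bigcap_{h>0}\Lambda_{M,h}$. $\mathcal{D}_{M,h}([-1,1])$ is the space of $f\in C^\infty(\mathbb{R},\mathbb{C})$ with $\operatorname{supp} f\subseteq[-1,1]$ and $\sup_{p\in\mathbb{N},x\in\mathbb{R}}|f^{(p)}(x)|/(h^pM_p)<+\infty$; $\mathcal{D}_{\{M\}}([-1,1]):=\bigcup_{h>0}\mathcal{D}_{M,h}([-1,1])$ and $\mathcal{D}_{(M)}([-1,1]):=\bigcap_{h>0}\mathcal{D}_{M,h}([-1,1])$. The Borel map is $\mathcal{B}(f):=(f^{(p)}(0))_{p\in\mathbb{N}}$. *)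

(* Defs.v *)
From HB Require Import structures.
From mathcomp Require Import all_boot all_order all_algebra.
From mathcomp Require Import complex.
From mathcomp Require Import all_classical all_reals all_analysis.

Set Implicit Arguments.
Unset Strict Implicit.
Unset Printing Implicit Defensive.

Import Order.TTheory GRing.Theory Num.Theory.
Import numFieldNormedType.Exports.

Local Open Scope classical_set_scope.
Local Open Scope ring_scope.

Section WeightSequences.
Context {R : realType}.
Implicit Types M N : nat -> R.

Definition posseq M := forall p, 0 < M p.

Definition LC : set (nat -> R) := [set N |
  [/\ posseq N,
      N 0%N = 1 /\ 1 <= N 1%N,
      forall j, (1 <= j)%N -> N j ^+ 2 <= N j.-1 * N j.+1
    & N j `^ (j%:R)^-1 @[j --> \oo] --> +oo]].

Definition quotseq N (j : nat) : R := if j is k.+1 then N k.+1 / N k else 1.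

Definition preceq M N :=
  (ereal_sup [set ((M j / N j) `^ (j%:R)^-1)%:E | j in [set j | (1 <= j)%N]]
    < +oo)%E.

Definition rootfact M (p : nat) : R := (M p / p`!%:R) `^ (p%:R)^-1.

Definition NR N : set (nat -> R) := [set M |
  [/\ posseq M, (0 < limn_einf (fun p => (rootfact M p)%:E))%E & preceq M N]].

Definition NB N : set (nat -> R) := [set M |
  [/\ posseq M, rootfact M p @[p --> \oo] --> +oo & preceq M N]].

(* A finite nonempty supremum when 1 <= p. *)
Definition lambdaMN M N (p s : nat) : R :=
  sup [set (M p / (s%:R ^+ p * N j)) `^ ((p - j)%N%:R)^-1
      | j in [set j | (j < p)%N]].

(* The tail series takes values in [0, +oo]; since lambdaMN M N p s > 0 for
   positive sequences, a divergent series makes the supremum infinite. *)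
Definition SV M N := exists2 s, (1 <= s)%N &
  (ereal_sup [set (lambdaMN M N p s / p%:R)%:E *
                  \sum_(p <= k <oo) ((quotseq N k)^-1)%:E
             | p in [set p | (1 <= p)%N]] < +oo)%E.

End WeightSequences.

Section ComplexSpaces.
Context {R : realType}.
Implicit Types (M : nat -> R) (f : R -> R[i]^o).

Definition Lambda_h M (h : R) : set (nat -> R[i]) := [set a |
  (ereal_sup [set (Normc.normc (a p) / (h ^+ p * M p))%:E | p in [set: nat]]
    < +oo)%E].

Definition Lambda_R M := \bigcup_(h in [set h : R | 0 < h]) Lambda_h M h.

Definition Lambda_B M := \bigcap_(h in [set h : R | 0 < h]) Lambda_h M h.

(* Derivatives of functions R -> C are taken on the real and imaginary
   parts; R[i] is not a normed module over R in the library. *)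
Definition csmooth f := forall n x,
  derivable (derive1n n (fun t => complex.Re (f t))) x 1 /\
  derivable (derive1n n (fun t => complex.Im (f t))) x 1.

Definition cderiv (n : nat) f (x : R) : R[i] :=
  (derive1n n (fun t => complex.Re (f t)) x +i*
   derive1n n (fun t => complex.Im (f t)) x)%C.

Definition D_h M (h : R) : set (R -> R[i]^o) := [set f |
  [/\ csmooth f,
      closure [set x | f x != 0] `<=` `[-1, 1]%classic
    & (ereal_sup [set (Normc.normc (cderiv p f x) / (h ^+ p * M p))%:E
                 | p in [set: nat] & x in [set: R]] < +oo)%E]].

Definition D_R M := \bigcup_(h in [set h : R | 0 < h]) D_h M h.

Definition D_B M := \bigcap_(h in [set h : R | 0 < h]) D_h M h.

Definition borel_map f : nat -> R[i] := fun p => cderiv p f 0.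

End ComplexSpaces.

Section Dimension.
Context {K : fieldType} {V : lmodType K}.
Implicit Types (B W A : set V).

Definition linear_subspace W :=
  W 0 /\ forall (a : K) u v, W u -> W v -> W (a *: u + v).

Definition linearly_independent B :=
  forall (n : nat) (b : 'I_n -> V) (c : 'I_n -> K),
    injective b -> (forall i, B (b i)) ->
    \sum_(i < n) c i *: b i = 0 -> forall i, c i = 0.

Definition linear_span B : set V := [set v |
  exists (n : nat) (b : 'I_n -> V) (c : 'I_n -> K),
    (forall i, B (b i)) /\ v = \sum_(i < n) c i *: b i].

Definition hamel_basis W B := linearly_independent B /\ linear_span B = W.

(* A is an affine space whose direction has a Hamel basis equipotent to I,
   i.e. A has dimension the cardinality of I. *)
Definition affine_space_of_dim (U : Type) (I : set U) A :=
  exists (f0 : V) (W : set V),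
    [/\ linear_subspace W, A = [set f0 + w | w in W]
      & exists2 B, hamel_basis W B & (B #= I)%card].

End Dimension.

(* Main.v *)
Require Import Defs.
From HB Require Import structures.
From mathcomp Require Import all_boot all_order all_algebra.
From mathcomp Require Import complex ring lra.
From mathcomp Require Import all_classical all_reals all_analysis.

Set Implicit Arguments.
Unset Strict Implicit.
Unset Printing Implicit Defensive.

Import Order.TTheory GRing.Theory Num.Theory.
Import numFieldNormedType.Exports.

Local Open Scope classical_set_scope.
Local Open Scope ring_scope.

(** The extension is the formal Taylor series summed with cut-offs,
        f(x) = sum_p a_p (x^p / p!) chi_p(x),
    where chi_p equals 1 near 0 and vanishes for |x| >= 5 r_p.  Near 0 the p-th
    term is a monomial, so f^(q)(0) = a_q as soon as the series may be
    differentiated term by term ([series_tower_tower]).  All the content is in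
    the size of the derivatives of chi_p.

    Cut-offs ([cutoff_exists]).  Given positive widths b_k of total at most r,
    there is a smooth cut-off at scale r with |chi^(q)| <= prod_(k < q) 1 / b_k.
    It is the limit of a trapezoid averaged successively over the windows
    [x - b_k, x + b_k].  Averaging costs nothing in sup norm, and the derivative
    of the limit is the limit, for the widths b_1, b_2, ..., started from the
    difference quotient of step b_0 ([mean_limit_taylor1]): so each derivative
    trades one width for one factor 1 / b_k.

    Choice of the widths.  Put nu_k = N_(k+1) / N_k and let lam_p be the supremum
    that occurs in the condition (M,N)_SV, for an s so large that lam_p <= nu_p.
    For the p-th cut-off take b_k = B_p / lam_p for k < p and b_k of order
    B_p / nu_k for k >= p.  Their sum is of order
    B_p (p / lam_p + sum_(k >= p) 1 / nu_k), which the condition bounds by a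
    multiple of B_p p / lam_p: this is the radius r_p.  On that support
    |x|^(p-i) / (p-i)! <= c^(p+1) (B_p / lam_p)^(p-i), and the definition of lam_p,
    that is M_p <= s^p N_q lam_p^(p-q) for q <= p, turns the Leibniz formula into
        |p-th term ^(q)| <= const (|a_p| / M_p) (const B_p)^p (2 / B_p)^q N_q
    ([weight_bound], [term_exists]).

    Say that f has type h when |f^(q)| <= D h^q N_q for some D and all q.
    Roumieu case: B_p = B is a small constant; the bound is summable in p and f
    has type 2 / B.  Beurling case: |a_p| / M_p decreases faster than every
    geometric sequence, which leaves room for B_p to tend to infinity
    ([radii_beurling]), and (2 / B_p)^q <= h^q for all but finitely many p.  Each
    of the remaining terms is itself of Beurling type, because the widths with
    k >= p are taken slightly larger than B_p / nu_k: their ratio to 1 / nu_k tends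
    to infinity while their sum at most doubles ([slower_summable]).  In both
    cases 5 r_p <= 1 requires lam_p to be at least of order p, resp. p = o(lam_p):
    this is what the growth of (M_p / p!)^(1/p) gives ([rootfact_growth]).

    The affine space.  Translates, indexed by the real line, of one bump of
    Beurling type supported away from 0 have zero jet at 0 and are linearly
    independent, since the leftmost translate of a finite combination has points
    of its support where all the others vanish ([bumps_independent]).  Their span
    is added to one extension. *)

(** * Antiderivatives and first order remainders *)

Section Antiderivatives.
Context {R : realType}.
Implicit Types (u v U : R -> R) (x y : R).

Definition lipschitz (L : R) u := forall x y, `|u x - u y| <= L * `|x - y|.

Lemma lipschitz_continuous L u : lipschitz L u -> continuous u.
Proof.
move=> Lu x; apply/cvgrPdist_le => e e0.
near=> y.
apply: (le_trans (Lu _ _)).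
have L1 : 0 < `|L| + 1 by rewrite ltr_wpDl.
apply: (@le_trans _ _ ((`|L| + 1) * `|x - y|)).
  apply: ler_wpM2r => //. rewrite (le_trans (ler_norm _))// lerDl//.
rewrite mulrC -ler_pdivlMr//.
near: y. apply: cvgr_dist_le; first exact: cvg_id. exact: divr_gt0.
Unshelve. all: by end_near. Qed.

Lemma is_derive1D u v x (du dv : R) : is_derive x 1 u du ->
  is_derive x 1 v dv -> is_derive x 1 (fun y => u y + v y) (du + dv).
Proof. exact: is_deriveD. Qed.

Lemma is_derive1Z (c : R) u x (du : R) : is_derive x 1 u du ->
  is_derive x 1 (fun y => c * u y) (c * du).
Proof. exact: is_deriveZ. Qed.

Lemma is_derive1M u v x (du dv : R) : is_derive x 1 u du ->
  is_derive x 1 v dv -> is_derive x 1 (fun y => u y * v y) (du * v x + u x * dv).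
Proof.
move=> hu hv; apply: (is_derive_eq (is_deriveM hu hv)).
by rewrite addrC -[v x *: du]/(v x * du) mulrC.
Qed.

Lemma is_derive1_affine u (c b : R) x (du : R) : is_derive (c * x + b) 1 u du ->
  is_derive x 1 (fun y => u (c * y + b)) (c * du).
Proof.
move=> hu; rewrite mulrC.
apply: (is_derive1_comp (f := u) (g := fun y => c * y + b)).
rewrite -[c in is_derive _ _ _ c]addr0 -[c in is_derive _ _ _ (c + _)]mulr1.
by apply: is_derive1D; apply: is_derive1Z.
Qed.

Lemma is_derive1_shift u (b : R) x (du : R) : is_derive (x + b) 1 u du ->
  is_derive x 1 (fun y => u (y + b)) du.
Proof.
move=> hu; rewrite -[du]mul1r; under eq_fun do rewrite -[_ + b](congr1 (+%R^~ b) (mul1r _)).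
by apply: is_derive1_affine; rewrite mul1r.
Qed.

(** All derivatives below are recognised through a quadratic remainder: such an
    inequality is preserved by means and by pointwise limits. *)
Lemma is_derive_quadratic u x (d L : R) :
  (forall h, `|u (x + h) - u x - h * d| <= L * h ^+ 2) -> is_derive x 1 u d.
Proof.
move=> H.
have C : h^-1 *: (u (h *: (1:R) + x) - u x) @[h --> 0^'] --> d.
  apply/cvgrPdist_le => e e0; near=> h.
  have h0 : h != 0 by near: h; exact: nbhs_dnbhs_neq.
  rewrite /= [h *: 1]mulr1 [_ *: _]/(_ * _) (addrC h).
  have -> : d - h^-1 * (u (x + h) - u x) = - (h^-1 * (u (x + h) - u x - h * d)).
    by rewrite [in RHS]mulrBr mulrA mulVf// mul1r opprB.
  rewrite normrN normrM normfV ler_pdivrMl ?normr_gt0//.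
  apply: (le_trans (H _)).
  have -> : h ^+ 2 = `|h| * `|h| by rewrite -normrM -expr2 ger0_norm// sqr_ge0.
  rewrite mulrCA ler_wpM2l//.
  have L1 : 0 < `|L| + 1 by rewrite ltr_wpDl.
  apply: (@le_trans _ _ ((`|L| + 1) * `|h|)).
    apply: ler_wpM2r => //. by rewrite (le_trans (ler_norm _))// lerDl.
  rewrite mulrC -ler_pdivlMr//.
  near: h.
  apply: dnbhs0_le; exact: divr_gt0.
apply: DeriveDef.
  by apply/cvg_ex; exists d.
exact: cvg_lim C.
Unshelve. all: by end_near. Qed.

(** The integral from -1 is an antiderivative to the right of -1, and to the left of
    0 it is the constant 0; the two domains cover the line. *)
Lemma antiderivative_right u : continuous u -> (forall x, x <= 0 -> u x = 0) ->
  exists U, forall x, is_derive x 1 U (u x).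
Proof.
move=> cu u0.
pose U (x : R) := (\int[lebesgue_measure]_(t in `[-1, x]) u t)%R.
exists U => x; have [x1|x1] := ltP (-1) x.
  have x2 : x < x + 1 by lra.
  have [|//||dU dUE] := @continuous_FTC1 R u (BLeft (-1)) x (x + 1) x2.
  - apply: continuous_compact_integrable; first exact: segment_compact.
    exact: continuous_subspaceT.
  - exact: cu.
  - apply: DeriveDef => //. by rewrite -derive1E.
have U0 : forall y, y < 0 -> U y = 0.
  move=> y y0; rewrite /U /Rintegral integral0_eq// => t /=.
  rewrite in_itv /= => /andP[_ ty]. by rewrite u0//; lra.
rewrite u0; last lra.
apply: (near_eq_is_derive _ (is_derive_cst (0:R) x 1)).
near=> y. rewrite U0 => [//|].
near: y. apply: lt_nbhsl. lra.
Unshelve. all: by end_near. Qed.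

(** After subtraction of u 0, the function is the sum of its restrictions to the two
    half-lines, each extended by 0 and each with an antiderivative, the left one
    after a reflection. *)
Lemma lipschitz_antiderivative L u : lipschitz L u ->
  exists U, forall x, is_derive x 1 U (u x).
Proof.
move=> Lu.
have L0 : 0 <= L.
  have := Lu 1 0; rewrite subr0 normr1 mulr1; exact: le_trans.
pose m (t : R) := Num.max t 0.
have mL : lipschitz 1 m.
  move=> x y; rewrite /m mul1r.
  have := ler_norm (x - y); have := ler_norm (y - x); rewrite (distrC y).
  by case: (leP x 0); case: (leP y 0) => *; rewrite ler_norml; lra.
have H (e : R) : `|e| = 1 -> exists U, forall x, is_derive x 1 U (u (e * m x) - u 0).
  move=> e1.
  apply: antiderivative_right.
    apply: (@lipschitz_continuous L) => x y.
    have -> : u (e * m x) - u 0 - (u (e * m y) - u 0) = u (e * m x) - u (e * m y) by ring.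
    apply: (le_trans (Lu _ _)); rewrite ler_wpM2l//.
    by rewrite -mulrBr normrM e1 mul1r (le_trans (mL _ _))// mul1r.
  by move=> x x0; rewrite /m max_r// mulr0 subrr.
have [U1 hU1] := H 1 (normr1 _).
have [U2 hU2] := H (-1) (normrN1 _).
exists (fun x => (U1 x + (-1) * U2 ((-1) * x + 0)) + u 0 * x) => x.
have -> : u x = (u (1 * m x) - u 0) +
    (-1) * ((-1) * (u (-1 * m ((-1) * x + 0)) - u 0)) + u 0 * 1.
  rewrite /m; case: (leP x 0) => x0.
    rewrite max_l; last lra.
    by rewrite mul1r mulr1 mulrA !mulN1r addr0 !opprK mul1r; ring.
  rewrite max_r; last lra.
  by rewrite mul1r mulr0 mulr1; ring.
have H3 := is_derive1Z (u 0) (is_derive_id x (1:R)).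
have H2 := is_derive1Z (-1) (is_derive1_affine (hU2 (-1 * x + 0))).
exact: is_derive1D (is_derive1D (hU1 x) H2) H3.
Qed.

Lemma mvt_abs U u : (forall x, is_derive x 1 U (u x)) -> forall x h,
  exists2 c, `|c - x| <= `|h| & U (x + h) - U x = h * u c.
Proof.
move=> hU x h.
have cU : continuous U.
  by move=> y; apply: differentiable_continuous; apply/derivable1_diffP; have [] := hU y.
have [h0|h0] := leP 0 h.
  have xh : x <= x + h by lra.
  have [c] := MVT_segment xh (fun y _ => hU y) (continuous_subspaceT cU).
  rewrite in_itv /= => /andP[c1 c2] E; exists c; last by rewrite E; ring.
  by rewrite (ger0_norm h0) ger0_norm; lra.
have xh : x + h <= x by lra.
have [c] := MVT_segment xh (fun y _ => hU y) (continuous_subspaceT cU).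
rewrite in_itv /= => /andP[c1 c2] E; exists c; last by rewrite -[LHS]opprB E; ring.
by rewrite (ltr0_norm h0) ler0_norm; lra.
Qed.

End Antiderivatives.

(** * Iterated means of a Lipschitz function *)

Section Means.
Context {R : realType}.
Implicit Types (u v g U a : R -> R) (x y : R).
Implicit Types (b : nat -> R).

Definition antiderivative u : R -> R := xget u [set U | forall x, is_derive x 1 U (u x)].

Lemma antiderivativeP L u : lipschitz L u ->
  forall x, is_derive x 1 (antiderivative u) (u x).
Proof.
move=> /lipschitz_antiderivative[U hU]; rewrite /antiderivative.
by case: xgetP => [V _ //|/(_ U)].
Qed.

(** The average of u over [x - r, x + r]. *)
Definition mean (r : R) u x :=
  (antiderivative u (x + r) - antiderivative u (x - r)) / (2 * r).

Definition diffquo (r : R) u x := (u (x + r) - u (x - r)) / (2 * r).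

(** A linear combination of averages over windows of the same width is the value of
    the combination at one common displacement, by the mean value theorem.  Three
    terms suffice for the remainder v (x + h) - v x - h g x, and all the properties
    of means below are instances. *)
Lemma mean_combination (r L1 L2 L3 : R) u1 u2 u3 (c1 c2 c3 x1 x2 x3 : R) :
  0 < r -> lipschitz L1 u1 -> lipschitz L2 u2 -> lipschitz L3 u3 ->
  exists2 t, `|t| <= r &
    c1 * mean r u1 x1 + c2 * mean r u2 x2 + c3 * mean r u3 x3 =
    c1 * u1 (x1 + t) + c2 * u2 (x2 + t) + c3 * u3 (x3 + t).
Proof.
move=> r0 /antiderivativeP h1 /antiderivativeP h2 /antiderivativeP h3.
pose W t := c1 * antiderivative u1 (t + x1) + c2 * antiderivative u2 (t + x2) +
            c3 * antiderivative u3 (t + x3).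
have dW (t : R) : is_derive t 1 W (c1 * u1 (x1 + t) + c2 * u2 (x2 + t) + c3 * u3 (x3 + t)).
  have D (c : R) v V y : (forall z : R, is_derive z 1 V (v z)) ->
      is_derive t 1 (fun t : R => c * V (t + y)) (c * v (y + t)).
    by move=> hV; rewrite (addrC y); apply/is_derive1Z/is_derive1_shift.
  exact: is_derive1D (is_derive1D (D _ _ _ _ h1) (D _ _ _ _ h2)) (D _ _ _ _ h3).
have cW : continuous W.
  by move=> y; apply: differentiable_continuous; apply/derivable1_diffP; have [] := dW y.
have rr : - r <= r by lra.
have [t] := MVT_segment rr (fun y _ => dW y) (continuous_subspaceT cW).
rewrite in_itv /= => /andP[t1 t2] E.
exists t; first by rewrite ler_norml t1.
have r2 : r - (- r) != 0 by lra.
move/(canRL (mulfK r2)): (esym E) => ->.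
rewrite /mean /W; have -> : r - - r = 2 * r by ring.
rewrite !(addrC (- r)) !(addrC r); ring.
Qed.

Lemma mean_value (r L : R) u x : 0 < r -> lipschitz L u ->
  exists2 t, `|t| <= r & mean r u x = u (x + t).
Proof.
move=> r0 Lu; have [t tr] := mean_combination 1 0 0 x x x r0 Lu Lu Lu.
by rewrite !mul0r !addr0 !mul1r => E; exists t.
Qed.

Lemma lipschitz_mean (r L : R) u : 0 < r -> lipschitz L u -> lipschitz L (mean r u).
Proof.
move=> r0 Lu x y; have [t tr] := mean_combination 1 (-1) 0 x y x r0 Lu Lu Lu.
rewrite !mul0r !addr0 !mul1r !mulN1r => ->; apply: (le_trans (Lu _ _)).
by rewrite opprD addrACA subrr addr0.
Qed.

Lemma lipschitz_diffquo (r L : R) u : 0 < r -> lipschitz L u -> lipschitz (L / r) (diffquo r u).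
Proof.
move=> r0 Lu x y; rewrite /diffquo.
have -> : (u (x + r) - u (x - r)) / (2 * r) - (u (y + r) - u (y - r)) / (2 * r) =
   ((u (x + r) - u (y + r)) - (u (x - r) - u (y - r))) / (2 * r) by ring.
rewrite normrM normfV (gtr0_norm (_ : 0 < 2 * r)); last lra.
rewrite ler_pdivrMr; last lra.
have -> : L / r * `|x - y| * (2 * r) = L * `|x - y| + L * `|x - y|.
  by field; rewrite gt_eqF.
apply: (le_trans (ler_normB _ _)); apply: lerD; apply: (le_trans (Lu _ _)).
  by rewrite opprD addrACA subrr addr0.
by rewrite opprD opprK addrACA addNr addr0.
Qed.

(** g is the derivative of v, with a remainder uniform in x. *)
Definition taylor1 (C : R) v g := forall x h, `|v (x + h) - v x - h * g x| <= C * h ^+ 2.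

Lemma taylor1_mean (r C L1 L2 : R) v g : 0 < r -> lipschitz L1 v -> lipschitz L2 g ->
  taylor1 C v g -> taylor1 C (mean r v) (mean r g).
Proof.
move=> r0 Lv Lg T x h.
have [t tr] := mean_combination 1 (-1) (- h) (x + h) x x r0 Lv Lv Lg.
rewrite !mul1r !mulN1r !mulNr => ->; by rewrite (addrAC x h t) T.
Qed.

(** Averaging differentiates: the derivative of the mean of u is its difference
    quotient of the same step. *)
Lemma taylor1_diffquo (r L : R) u : 0 < r -> lipschitz L u ->
  taylor1 (L / r) (mean r u) (diffquo r u).
Proof.
move=> r0 Lu x h; have hU := antiderivativeP Lu.
set U := antiderivative u in hU.
have L0 : 0 <= L.
  have := Lu 1 0; rewrite subr0 normr1 mulr1; exact: le_trans.
have rem y : `|U (y + h) - U y - h * u y| <= L * h ^+ 2.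
  have [c cy ->] := mvt_abs hU y h.
  rewrite -mulrBr normrM.
  have -> : L * h ^+ 2 = `|h| * (L * `|h|).
    by rewrite [RHS]mulrCA -normrM -expr2 ger0_norm// sqr_ge0.
  by rewrite ler_wpM2l// (le_trans (Lu _ _))// ler_wpM2l.
rewrite /mean /diffquo -/U.
have -> : (U (x + h + r) - U (x + h - r)) / (2 * r) - (U (x + r) - U (x - r)) / (2 * r) -
   h * ((u (x + r) - u (x - r)) / (2 * r)) =
   ((U (x + r + h) - U (x + r) - h * u (x + r)) -
    (U (x - r + h) - U (x - r) - h * u (x - r))) / (2 * r).
  by rewrite !(addrAC x h); ring.
rewrite normrM normfV (gtr0_norm (_ : 0 < 2 * r)); last lra.
rewrite ler_pdivrMr; last lra.
have -> : L / r * h ^+ 2 * (2 * r) = L * h ^+ 2 + L * h ^+ 2.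
  by field; rewrite gt_eqF.
by apply: (le_trans (ler_normB _ _)); apply: lerD.
Qed.

Fixpoint means b m u : R -> R := if m is k.+1 then mean (b k) (means b k u) else u.

Definition shiftn b n : nat -> R := fun k => b (n + k)%N.

Lemma meansS b m u : means b m.+1 u = means (shiftn b 1) m (mean (b 0%N) u).
Proof. by elim: m => //= m <-. Qed.

Lemma lipschitz_means b m (L : R) u : (forall k, 0 < b k) -> lipschitz L u ->
  lipschitz L (means b m u).
Proof. by move=> b0 Lu; elim: m => //= m IH; exact: lipschitz_mean. Qed.

Lemma taylor1_means b m (C L1 L2 : R) v g : (forall k, 0 < b k) ->
  lipschitz L1 v -> lipschitz L2 g ->
  taylor1 C v g -> taylor1 C (means b m v) (means b m g).
Proof.
move=> b0 Lv Lg T; elim: m => //= m IH.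
exact: taylor1_mean (b0 m) (lipschitz_means m b0 Lv) (lipschitz_means m b0 Lg) IH.
Qed.

Lemma means_bounded b m (L C : R) u : (forall k, 0 < b k) -> lipschitz L u ->
  (forall x, `|u x| <= C) -> forall x, `|means b m u x| <= C.
Proof.
move=> b0 Lu uC; elim: m => //= m IH x.
by have [t _ ->] := mean_value x (b0 m) (lipschitz_means m b0 Lu).
Qed.

(** The m-fold mean at x depends only on the values of u at distance at most the sum
    of the m widths. *)
Lemma means_local b m (L c : R) u x : (forall k, 0 < b k) -> lipschitz L u ->
  (forall y, `|y - x| <= \sum_(k < m) b k -> u y = c) -> means b m u x = c.
Proof.
move=> b0 Lu; elim: m x => [|m IH] x H /=.
  by apply: H; rewrite subrr normr0 big_ord0.
have [t tb ->] := mean_value x (b0 m) (lipschitz_means m b0 Lu).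
apply: IH => y yx; apply: H; rewrite big_ord_recr/=.
have -> : y - x = (y - (x + t)) + t by ring.
by rewrite (le_trans (ler_normD _ _))// lerD.
Qed.

Lemma means_step b m (L : R) u x : (forall k, 0 < b k) -> lipschitz L u ->
  `|means b m.+1 u x - means b m u x| <= L * b m.
Proof.
move=> b0 Lu /=; have Lm := lipschitz_means m b0 Lu.
have [t tb ->] := mean_value x (b0 m) Lm.
have L0 : 0 <= L.
  have := Lu 1 0; rewrite subr0 normr1 mulr1; exact: le_trans.
by apply: (le_trans (Lm _ _)); rewrite (addrC x) addrK ler_wpM2l.
Qed.

Definition bounded_sums (s : R) b := (forall k, 0 < b k) /\ (forall n, \sum_(k < n) b k <= s).

Definition mean_limit b u x := limn (fun m => means b m u x).

Lemma cvg_of_summable_steps (w c : nat -> R) (s : R) :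
  (forall m, `|w m.+1 - w m| <= c m) -> (forall n, \sum_(k < n) c k <= s) -> cvgn w.
Proof.
move=> wc cs.
have S : cvgn (series (fun m => w m.+1 - w m)).
  apply: normed_cvg; apply: nondecreasing_is_cvgn.
    by apply: nondecreasing_series => n _ _ /=.
  exists s => _ [n _ <-] /=; rewrite /series/= big_mkord.
  by apply: le_trans (cs n); apply: ler_sum.
have -> : w = (fun n => series (fun m => w m.+1 - w m) n + w 0%N).
  by apply/funext => n; rewrite /series/= telescope_sumr// subrK.
by apply: is_cvgD => //; exact: is_cvg_cst.
Qed.

Lemma mean_limit_cvg b (s L : R) u x : bounded_sums s b -> lipschitz L u ->
  means b m u x @[m --> \oo] --> mean_limit b u x.
Proof.
move=> [b0 bs] Lu; apply: (@cvg_of_summable_steps _ (fun m => L * b m) (L * s)).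
  by move=> m; exact: means_step.
move=> n; rewrite -mulr_sumr ler_wpM2l//.
have := Lu 1 0; rewrite subr0 normr1 mulr1; exact: le_trans.
Qed.

Lemma cvg_norm_le (w : nat -> R) (l C : R) :
  w @ \oo --> l -> (forall n, `|w n| <= C) -> `|l| <= C.
Proof.
move=> wl wC; have wl' : `|w n| @[n --> \oo] --> `|l| by exact: cvg_norm.
rewrite -(cvg_lim _ wl')//; apply: limr_le; first by apply/cvg_ex; exists `|l|.
by apply: nearW.
Qed.

Lemma mean_limit_bounded b (s L C : R) u : bounded_sums s b -> lipschitz L u ->
  (forall x, `|u x| <= C) -> forall x, `|mean_limit b u x| <= C.
Proof.
move=> bs Lu uC x; apply: (cvg_norm_le (mean_limit_cvg bs Lu)) => m.
by apply: (means_bounded m (proj1 bs) Lu).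
Qed.

Lemma mean_limit_local b (s L c : R) u x : bounded_sums s b -> lipschitz L u ->
  (forall y, `|y - x| <= s -> u y = c) -> mean_limit b u x = c.
Proof.
move=> bs Lu H.
rewrite /mean_limit (_ : (fun m => _) = (fun=> c)) ?lim_cst//.
apply/funext => m; apply: (means_local (proj1 bs) Lu) => y yx; apply: H.
exact: le_trans yx (proj2 bs m).
Qed.

Lemma bounded_sums_shiftn n b (s : R) : bounded_sums s b ->
  bounded_sums (s - \sum_(k < n) b k) (shiftn b n).
Proof.
move=> [b0 bs]; split => [k|m]; first exact: b0.
rewrite lerBrDl; apply: le_trans (bs (n + m)%N); rewrite big_split_ord/= lexx//.
Qed.

(** The first mean turns u into a function with derivative the difference quotient
    of u; the remaining means preserve that relation with the same constant, hence so
    does their limit. *)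
Lemma mean_limit_taylor1 b (s L : R) u : bounded_sums s b -> lipschitz L u ->
  taylor1 (L / b 0%N) (mean_limit b u) (mean_limit (shiftn b 1) (diffquo (b 0%N) u)).
Proof.
move=> bs Lu x h; have [b0 _] := bs.
have bs1 := bounded_sums_shiftn 1 bs.
have Ld := lipschitz_diffquo (b0 0%N) Lu.
have Lm := lipschitz_mean (b0 0%N) Lu.
have c1 y : means (shiftn b 1) m (mean (b 0%N) u) y @[m --> \oo] --> mean_limit b u y.
  have := mean_limit_cvg (x := y) bs Lu; rewrite -(cvg_shiftS (fun m => means b m u y)).
  by under eq_fun do rewrite meansS.
apply: (cvg_norm_le (w := fun m => means (shiftn b 1) m (mean (b 0%N) u) (x + h) -
  means (shiftn b 1) m (mean (b 0%N) u) x - h * means (shiftn b 1) m (diffquo (b 0%N) u) x)).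
  apply: cvgB; first by apply: cvgB.
  by apply: cvgMr; exact: mean_limit_cvg bs1 Ld.
move=> m; apply: taylor1_means Lm Ld _ _ _ => //.
  by move=> k; exact: b0.
exact: taylor1_diffquo.
Qed.

End Means.

(** * Cut-offs, products and series of functions with prescribed derivatives *)

Section Towers.
Context {R : realType}.
Implicit Types (u v g : R -> R) (x y : R) (b : nat -> R) (F G : nat -> R -> R).

(** A smooth function together with all its derivatives: the n-th function is the
    n-th derivative of the first one.  Bounds on derivatives are then pointwise
    bounds on explicit functions. *)
Definition tower F := forall n x, is_derive x 1 (F n) (F n.+1 x).

Lemma tower_derive1n F n : tower F -> derive1n n (F 0%N) = F n.
Proof.
move=> tF; elim: n => // n IH.
rewrite derive1nS IH; apply/funext => x.
by have [_ <-] := tF n x; rewrite derive1E.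
Qed.

Fixpoint diffquos b n u := if n is k.+1 then diffquo (b k) (diffquos b k u) else u.

Lemma lipschitz_diffquos b n u L : (forall k, 0 < b k) -> lipschitz L u ->
  exists L', lipschitz L' (diffquos b n u).
Proof.
move=> b0 Lu; elim: n => [|n [L' IH]] /=; first by exists L.
by exists (L' / b n); exact: lipschitz_diffquo.
Qed.

Lemma diffquos_bounded b n u : (forall k, 0 < b k) -> (forall x, `|u x| <= 1) ->
  forall x, `|diffquos b n u x| <= \prod_(k < n) (b k)^-1.
Proof.
move=> b0 u1; elim: n => [|n IH] x /=; first by rewrite big_ord0.
rewrite big_ord_recr/= /diffquo normrM normfV (gtr0_norm (_ : 0 < 2 * b n)); last first.
  by rewrite mulr_gt0.
rewrite ler_pdivrMr ?mulr_gt0//.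
have -> z : z / b n * (2 * b n) = z + z by field; rewrite gt_eqF.
apply: le_trans (ler_normB _ _) _.
have := IH (x + b n); have := IH (x - b n); lra.
Qed.

Lemma diffquos_local b n u (c x : R) : (forall k, 0 < b k) ->
  (forall y, `|y - x| <= \sum_(k < n) b k -> u y = c) ->
  diffquos b n u x = if n is 0 then c else 0.
Proof.
move=> b0; elim: n x => [|n IH] x H /=.
  by apply: H; rewrite subrr normr0 big_ord0.
have E y : `|y - x| <= b n -> diffquos b n u y = if n is 0 then c else 0.
  move=> yx; apply: IH => z zy; apply: H; rewrite big_ord_recr/=.
  have -> : z - x = (z - y) + (y - x) by ring.
  by rewrite (le_trans (ler_normD _ _))// lerD.
rewrite /diffquo !E ?subrr ?mul0r// addrC addKr ?normrN gtr0_norm//.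
Qed.

(** The n-th derivative of the limit of the means of u: the first n widths have
    been spent on difference quotients. *)
Definition smoothing b u n := mean_limit (shiftn b n) (diffquos b n u).

Lemma smoothing_tower b (s L : R) u : bounded_sums s b -> lipschitz L u ->
  tower (smoothing b u).
Proof.
move=> bs Lu n x; have [L' Ln] := lipschitz_diffquos n (proj1 bs) Lu.
have T := mean_limit_taylor1 (bounded_sums_shiftn n bs) Ln.
have b0 : shiftn b n 0 = b n by rewrite /shiftn addn0.
have b1 : shiftn (shiftn b n) 1 = shiftn b n.+1.
  by apply/funext => k; rewrite /shiftn addnA addn1.
rewrite b0 b1 in T; apply: is_derive_quadratic => h; exact: T.
Qed.

Lemma smoothing_bounded b (s L : R) u : bounded_sums s b -> lipschitz L u ->
  (forall x, `|u x| <= 1) ->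
  forall n x, `|smoothing b u n x| <= \prod_(k < n) (b k)^-1.
Proof.
move=> bs Lu u1 n x; have [L' Ln] := lipschitz_diffquos n (proj1 bs) Lu.
apply: (mean_limit_bounded (bounded_sums_shiftn n bs) Ln).
exact: diffquos_bounded (proj1 bs) u1.
Qed.

Lemma smoothing_local b (s L c x : R) u : bounded_sums s b -> lipschitz L u ->
  (forall y, `|y - x| <= s -> u y = c) ->
  forall n, smoothing b u n x = if n is 0 then c else 0.
Proof.
move=> bs Lu H n; have [L' Ln] := lipschitz_diffquos n (proj1 bs) Lu.
apply: (mean_limit_local (bounded_sums_shiftn n bs) Ln) => y yx.
apply: (diffquos_local (proj1 bs)) => z zy; apply: H.
have -> : z - x = (z - y) + (y - x) by ring.
by apply: (le_trans (ler_normD _ _)); lra.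
Qed.

Lemma dist_max_le (c x y : R) : `|Num.max c x - Num.max c y| <= `|x - y|.
Proof.
have := ler_norm (x - y); have := ler_norm (y - x); rewrite (distrC y).
by case: (leP c x) => ?; case: (leP c y) => ? ? ?; rewrite ler_norml; lra.
Qed.

Lemma dist_min_le (c x y : R) : `|Num.min c x - Num.min c y| <= `|x - y|.
Proof.
have := ler_norm (x - y); have := ler_norm (y - x); rewrite (distrC y).
by case: (leP c x) => ?; case: (leP c y) => ? ? ?; rewrite ler_norml; lra.
Qed.

(** Equal to 1 for |x| <= 2 r and to 0 for |x| >= 4 r: means over windows of total
    width r leave it equal to 1 on [-r, r] and to 0 beyond 5 r. *)
Definition trapezoid (r x : R) := Num.max 0 (Num.min 1 (2 - `|x| / (2 * r))).

Lemma lipschitz_trapezoid r : 0 < r -> lipschitz (1 / (2 * r)) (trapezoid r).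
Proof.
move=> r0 x y.
have H : `| `|x| / (2 * r) - `|y| / (2 * r)| <= 1 / (2 * r) * `|x - y|.
  rewrite -mulrBl normrM normfV (gtr0_norm (_ : 0 < 2 * r)); last lra.
  rewrite mul1r mulrC ler_wpM2l ?ler_dist_dist//.
  by rewrite invr_ge0; lra.
apply: le_trans H; rewrite /trapezoid.
apply: le_trans (dist_max_le _ _ _) _; apply: le_trans (dist_min_le _ _ _) _.
move: (`|x| / _) (`|y| / _) => p q.
by rewrite [leRHS]distrC; have -> : 2 - p - (2 - q) = q - p by ring.
Qed.

Lemma cutoff_exists b (r : R) : 0 < r -> bounded_sums r b ->
  exists chi, [/\ tower chi,
    forall n x, `|x| <= r -> chi n x = (n == 0%N)%:R,
    forall n x, 5 * r <= `|x| -> chi n x = 0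
    & forall n x, `|chi n x| <= \prod_(k < n) (b k)^-1].
Proof.
move=> r0 bs; have Lu := lipschitz_trapezoid r0.
exists (smoothing b (trapezoid r)); split.
- exact: smoothing_tower bs Lu.
- move=> n x xr; rewrite (smoothing_local (c := 1) bs Lu); first by case: n.
  move=> y yx; rewrite /trapezoid min_l ?max_r//.
  rewrite lerBrDr -lerBrDl ler_pdivrMr; last lra.
  have : `|y| <= `|y - x| + `|x| by rewrite -{1}[y](subrK x) ler_normD.
  lra.
- move=> n x xr; rewrite (smoothing_local (c := 0) bs Lu); first by case: n.
  move=> y yx; rewrite /trapezoid max_l// ge_min lerBlDr add0r ler_pdivlMr; last lra.
  have : `|x| <= `|y - x| + `|y| by rewrite distrC -{1}[x](subrK y) ler_normD.
  move=> ?; apply/orP; right; lra.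
- apply: smoothing_bounded bs Lu _ => x; rewrite /trapezoid.
  by rewrite ger0_norm ?le_max ?lexx// ge_max ler01 ge_min lexx.
Qed.

(** The q-th derivative of a product, as the sum of its 2^q terms; the recursion
    replaces the binomial coefficients, and the factor 2^q is harmless below. *)
Fixpoint leibniz q F G : R -> R := if q is k.+1 then
  fun x => leibniz k (fun n => F n.+1) G x + leibniz k F (fun n => G n.+1) x
  else fun x => F 0%N x * G 0%N x.

Lemma leibniz_tower F G : tower F -> tower G -> tower (fun q => leibniz q F G).
Proof.
move=> tF tG n; elim: n F G tF tG => [|n IH] F G tF tG x.
  exact: is_derive1M (tF 0%N x) (tG 0%N x).
apply: is_derive1D (IH (fun n => F n.+1) G _ tG x) (IH F (fun n => G n.+1) tF _ x).
  by move=> k y; exact: tF.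
by move=> k y; exact: tG.
Qed.

(** When the products of derivatives are bounded according to their total order, the
    2^q terms have the same bound. *)
Lemma leibniz_bounded q F G (K : nat -> R) x :
  (forall i j, `|F i x * G j x| <= K (i + j)%N) -> `|leibniz q F G x| <= 2 ^+ q * K q.
Proof.
elim: q F G K => [|q IH] F G K H /=; first by rewrite expr0 mul1r H.
apply: le_trans (ler_normD _ _) _.
rewrite exprS -mulrA mulr_natl mulr2n.
apply: lerD; apply: (IH _ _ (fun n => K n.+1)) => i j.
  by rewrite -addSn.
by rewrite -addnS.
Qed.

Lemma leibniz_local_one q F G x : G 0%N x = 1 -> (forall n, G n.+1 x = 0) ->
  leibniz q F G x = F q x.
Proof.
move=> G1 G0; elim: q F => [|q IH] F /=; first by rewrite G1 mulr1.
rewrite IH -[RHS]addr0; congr +%R; apply/eqP; rewrite -normr_le0.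
rewrite -(mulr0 (2 ^+ q)); apply: (@leibniz_bounded _ _ _ (fun=> 0)) => i j.
by rewrite G0 mulr0 normr0.
Qed.

Definition monomial p n x : R := if (n <= p)%N then x ^+ (p - n) / (p - n)`!%:R else 0.

Lemma monomial_tower p : tower (monomial p).
Proof.
move=> n x; rewrite /monomial; case: (ltnP n p) => np.
  rewrite (ltnW np); have -> : (p - n = (p - n.+1).+1)%N by rewrite subnSK.
  set k := (p - n.+1)%N.
  have D := is_derive1Z (k.+1`!%:R^-1) (is_deriveX k.+1 (is_derive_id x (1:R))).
  have E : (fun y : R => k.+1`!%:R^-1 * (id ^+ k.+1) y) = (fun y => y ^+ k.+1 / k.+1`!%:R).
    by apply/funext => y; rewrite mulrC exprfctE.
  rewrite E in D; apply: (is_derive_eq D).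
  rewrite [_ *: 1]mulr1 /= factS natrM; field.
  by rewrite nat1r !pnatr_eq0 -lt0n fact_gt0.
have [->|] := eqVneq n p; first by rewrite leqnn subnn; under eq_fun do rewrite expr0; exact: is_derive_cst.
rewrite neq_ltn ltnNge np/= => pn; rewrite leqNgt pn; exact: is_derive_cst.
Qed.

Lemma monomial0 p n : monomial p n 0 = (n == p)%:R.
Proof.
rewrite /monomial expr0n subn_eq0; case: (ltngtP n p) => [np|np|->].
- by rewrite mul0r.
- by [].
- by rewrite subnn fact0 divr1.
Qed.

Definition series_tower (F : nat -> nat -> R -> R) q x := limn (fun n => \sum_(p < n) F p q x).

(** Two applications of the mean value theorem; a bound on the second derivative
    gives a quadratic remainder that can be summed. *)
Lemma tower_taylor1 F q (C : R) : tower F -> (forall x, `|F q.+2 x| <= C) ->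
  taylor1 C (F q) (F q.+1).
Proof.
move=> tF FC x h.
have [c cx ->] := mvt_abs (tF q) x h.
have [d _ E] := mvt_abs (tF q.+1) x (c - x).
rewrite -mulrBr -{1}(subrK x c) (addrC _ x) E !normrM mulrA.
have C0 : 0 <= C by apply: le_trans (FC 0).
have -> : C * h ^+ 2 = `|h| * `|h| * C by rewrite -normrM -expr2 ger0_norm ?sqr_ge0// mulrC.
by apply: ler_pM => //; rewrite ler_wpM2l.
Qed.

Section SeriesTower.
Variables (F : nat -> nat -> R -> R) (c : nat -> nat -> R) (S : nat -> R).
Hypothesis tF : forall p, tower (F p).
Hypothesis Fc : forall p q x, `|F p q x| <= c p q.
Hypothesis cS : forall q n, \sum_(p < n) c p q <= S q.

Lemma series_tower_cvg q x : \sum_(p < n) F p q x @[n --> \oo] --> series_tower F q x.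
Proof.
apply: (cvg_of_summable_steps (c := fun p => c p q) (s := S q)) => // m.
by rewrite big_ord_recr/= addrAC subrr add0r.
Qed.

Lemma series_tower_bounded q x : `|series_tower F q x| <= S q.
Proof.
apply: (cvg_norm_le (@series_tower_cvg q x)) => n.
by apply: le_trans (ler_norm_sum _ _ _) _; apply: le_trans (cS q n); exact: ler_sum.
Qed.

Lemma series_tower_tower : tower (series_tower F).
Proof.
move=> q x; apply: (@is_derive_quadratic _ _ _ _ (S q.+2)) => h.
apply: (cvg_norm_le (w := fun n => \sum_(p < n) F p q (x + h) - \sum_(p < n) F p q x -
   h * \sum_(p < n) F p q.+1 x)).
  apply: cvgB; first by apply: cvgB; exact: series_tower_cvg.
  by apply: cvgMr; exact: series_tower_cvg.
move=> n; rewrite mulr_sumr -!sumrB.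
apply: le_trans (ler_norm_sum _ _ _) _.
apply: (@le_trans _ _ (\sum_(p < n) c p q.+2 * h ^+ 2)).
  by apply: ler_sum => p _; exact: tower_taylor1.
by rewrite -mulr_suml ler_wpM2r ?sqr_ge0.
Qed.

End SeriesTower.

End Towers.

(** * Choice of the widths *)

Section WidthChoice.
Context {R : realType}.
Implicit Types (x y : R) (N : nat -> R).

Lemma prod_eventually_le1 (rho : nat -> R) n0 : (forall k, 0 <= rho k) ->
  (forall k, (n0 <= k)%N -> rho k <= 1) ->
  forall q, \prod_(k < q) rho k <= \prod_(k < n0) (1 + rho k).
Proof.
move=> rho0 rho1.
have P0 q : 0 <= \prod_(k < q) rho k by apply: prodr_ge0.
have le1 n : 1 <= 1 + rho n by rewrite lerDl.
have mono m n : (m <= n)%N -> \prod_(k < m) (1 + rho k) <= \prod_(k < n) (1 + rho k).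
  move=> /subnK <-; elim: (n - m)%N => // d; rewrite addSn big_ord_recr/= => IH.
  apply: le_trans IH _; apply: ler_peMr => //.
  by apply: prodr_ge0 => k _; apply: le_trans (le1 k).
elim=> [|q IH].
  by have := mono 0%N n0 isT; rewrite !big_ord0.
have [q0|q0] := leqP n0 q.
  by rewrite big_ord_recr/=; apply: le_trans IH; rewrite ler_piMr ?rho1 ?P0.
apply: le_trans (mono _ _ q0).
by apply: ler_prod => k _; apply/andP; split; [exact: rho0|rewrite lerDr].
Qed.

(** Passing from z = o(w) to products gains every geometric factor: this is how a
    Beurling estimate arises. *)
Lemma prod_negligible (z w : nat -> R) : (forall k, 0 < z k) -> (forall k, 0 < w k) ->
  (forall e, 0 < e -> exists n0, forall k, (n0 <= k)%N -> z k <= e * w k) ->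
  forall h, 0 < h -> exists C, forall q, \prod_(k < q) z k <= C * h ^+ q * \prod_(k < q) w k.
Proof.
move=> z0 w0 zw h h0; have [n0 H] := zw _ h0.
exists (\prod_(k < n0) (1 + z k / (h * w k))) => q.
have hw k : 0 < h * w k by rewrite mulr_gt0.
have := @prod_eventually_le1 (fun k => z k / (h * w k)) n0 _ _ q.
rewrite big_split/= prodfV big_split/= prodr_const card_ord.
rewrite ler_pdivrMr ?mulr_gt0 ?exprn_gt0 ?prodr_gt0// mulrA; apply.
  by move=> k; rewrite ltW// divr_gt0.
by move=> k /H; rewrite ler_pdivrMr// mul1r.
Qed.

(** With T_k the tails of the series, c_k = 2 sqrt(T_0) (sqrt(T_k) - sqrt(T_(k+1)))
    telescopes to at most 2 T_0, while
    c_k / y_k = 2 sqrt(T_0) / (sqrt(T_k) + sqrt(T_(k+1))) is at least 1 and tends to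
    infinity. *)
Lemma slower_summable (y : nat -> R) (T : R) : (forall k, 0 < y k) ->
  (forall n, \sum_(k < n) y k <= T) ->
  exists c : nat -> R, [/\ forall k, y k <= c k,
    forall n, \sum_(k < n) c k <= 2 * T
    & forall e, 0 < e -> exists n0, forall k, (n0 <= k)%N -> y k <= e * c k].
Proof.
move=> y0 yT.
pose s n := \sum_(k < n) y k.
have sS n : s n.+1 = s n + y n by rewrite /s big_ord_recr.
have cs : cvgn s.
  apply: (cvg_of_summable_steps (c := y) (s := T)) => // m.
  by rewrite sS addrC addKr gtr0_norm.
pose S := limn s.
have s_lt n : s n < S.
  have : s n.+1 <= S.
    apply: limr_ge => //; exists n.+1 => // m /= /subnK <-.
    by elim: (m - n.+1)%N => // d IH; apply: le_trans IH _; rewrite addSn sS lerDl ltW.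
  by apply: lt_le_trans; rewrite sS ltrDl.
have ST : S <= T by apply: limr_le => //; apply: nearW.
pose t n := S - s n.
have t0 n : 0 < t n by rewrite subr_gt0.
have tS n : y n = t n - t n.+1 by rewrite /t sS; ring.
pose q n := Num.sqrt (t n).
have q0 n : 0 < q n by rewrite sqrtr_gt0.
have qq n : q n ^+ 2 = t n by rewrite sqr_sqrtr// ltW.
have q_decr m n : (m <= n)%N -> q n <= q m.
  move=> /subnK <-; elim: (n - m)%N => // d IH; apply: le_trans IH.
  by rewrite addSn /q ler_wsqrtr// -subr_ge0 -tS ltW.
have yq n : y n = (q n - q n.+1) * (q n + q n.+1) by rewrite tS -!qq; ring.
exists (fun n => 2 * q 0%N * (q n - q n.+1)); split.
- move=> k; rewrite yq mulrC ler_wpM2r ?subr_ge0 ?q_decr//.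
  by have := q_decr 0%N k isT; have := q_decr 0%N k.+1 isT; lra.
- move=> n; rewrite -mulr_sumr.
  have -> : \sum_(k < n) (q k - q k.+1) = q 0%N - q n.
    by elim: n => [|n IH]; rewrite ?big_ord0 ?subrr// big_ord_recr/= IH; ring.
  have : q 0%N ^+ 2 <= T by rewrite qq /t /s big_ord0 subr0.
  have := q0 0%N; have := q0 n; nra.
- move=> e e0.
  have e1 : 0 < e * q 0%N by rewrite mulr_gt0.
  have [n0 _ Hn] : \forall n \near \oo, `|S - s n| < (e * q 0%N) ^+ 2.
    by apply: cvgr_dist_lt; rewrite ?exprn_gt0.
  have qe k : (n0 <= k)%N -> q k <= e * q 0%N.
    move=> /Hn /=; rewrite gtr0_norm ?subr_gt0// -/(t k) -qq => /ltW.
    by rewrite ler_sqr// nnegrE ltW.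
  exists n0 => k k0; rewrite yq.
  have -> : e * (2 * q 0%N * (q k - q k.+1)) = (q k - q k.+1) * (2 * (e * q 0%N)) by ring.
  rewrite ler_wpM2l ?subr_ge0 ?q_decr//.
  have := qe _ k0; have := qe _ (leqW k0); lra.
Qed.

Lemma expfact_le x n : 0 <= x -> x ^+ n / n`!%:R <= expR x.
Proof.
case: n => [|n] x0; last by apply: le_trans (expR_ge1Dxn n x0); rewrite lerDr.
rewrite expr0 fact0 divr1; apply: le_trans (expR_ge1Dx x); rewrite lerDl//.
Qed.

Lemma geometric_sum_le2 n : \sum_(p < n) (2^-1 : R) ^+ p <= 2.
Proof.
suff -> : \sum_(p < n) (2^-1 : R) ^+ p = 2 - 2 * 2^-1 ^+ n.
  by rewrite lerBlDr lerDl mulr_ge0// exprn_ge0// invr_ge0.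
elim: n => [|n IH]; first by rewrite big_ord0 expr0 mulr1 subrr.
by rewrite big_ord_recr/= IH exprS; field.
Qed.

Section Widths.
Variables (N : nat -> R) (p : nat) (lam B T r : R).
Hypothesis N_gt0 : forall k, 0 < N k.
Hypothesis N0 : N 0%N = 1.
Let nu k := N k.+1 / N k.
Hypothesis lam_gt0 : 0 < lam.
Hypothesis B_gt0 : 0 < B.
Hypothesis lam_nu : forall k, (p <= k)%N -> lam <= nu k.
Hypothesis nuT : forall n, \sum_(k < n) (nu (p + k)%N)^-1 <= T.
Hypothesis r_ge : B * (p%:R / lam + 2 * T) <= r.

(** The widths of the p-th cut-off.  Those with k >= p are
    B min(1 / lam, c_(k-p)), where c is a summable majorant of 1 / nu with
    c nu -> oo: the minimum keeps every 1 / b_k above lam / B, and the bounds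
    1 / c <= nu and lam <= nu keep it below nu_k / B, with ratio tending to 0. *)
Lemma widths_exist : exists b : nat -> R, [/\ bounded_sums r b,
  forall k, (k < p)%N -> (b k)^-1 = lam / B,
  forall k, lam / B <= (b k)^-1,
  forall k, (p <= k)%N -> (b k)^-1 <= nu k / B
  & forall h, 0 < h -> exists C, forall q, \prod_(k < q) (b k)^-1 <= C * h ^+ q * N q].
Proof.
have nu0 k : 0 < nu k by rewrite divr_gt0.
have [|//|c [c1 c2 c3]] := @slower_summable (fun k => (nu (p + k)%N)^-1) T.
  by move=> k; rewrite invr_gt0.
have c0 k : 0 < c k by apply: lt_le_trans (c1 k); rewrite invr_gt0.
pose b k := B * (if (k < p)%N then lam^-1 else Num.min lam^-1 (c (k - p)%N)).
have b0 k : 0 < b k.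
  by rewrite mulr_gt0//; case: ifP; rewrite ?lt_min ?c0 ?invr_gt0 ?lam_gt0.
have bV k : b k <= B / lam -> lam / B <= (b k)^-1.
  by move=> H; rewrite -(invrK (lam / B)) lef_pV2 ?posrE ?invr_gt0 ?divr_gt0// invf_div.
exists b; split.
- split=> // n.
  apply: le_trans r_ge.
  apply: (@le_trans _ _ (\sum_(k < p + n) b k)).
    rewrite addnC big_split_ord/= lerDl; apply: sumr_ge0 => k _; exact: ltW.
  rewrite big_split_ord/= mulrDr; apply: lerD.
    rewrite (eq_bigr (fun=> B / lam)); last by move=> k _; rewrite /b ltn_ord.
    rewrite sumr_const card_ord -[leLHS]mulr_natr.
    by have -> : B / lam * p%:R = B * (p%:R / lam) by ring.
  apply: (@le_trans _ _ (\sum_(k < n) B * c k)).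
    apply: ler_sum => k _; rewrite /b ltnNge leq_addr/= addKn ler_wpM2l ?(ltW B_gt0)//.
    by rewrite ge_min lexx orbT.
  by rewrite -mulr_sumr ler_wpM2l ?(ltW B_gt0)//.
- by move=> k kp; rewrite /b kp invf_div.
- move=> k; apply: bV; rewrite /b ler_wpM2l ?(ltW B_gt0)//.
  by case: ifP => // _; rewrite ge_min lexx.
- move=> k pk; rewrite -[nu k / B]invrK invf_div lef_pV2 ?posrE ?divr_gt0//.
  rewrite /b ltnNge pk/= ler_wpM2l ?(ltW B_gt0)// le_min.
  rewrite lef_pV2 ?posrE// lam_nu//=.
  by apply: le_trans (c1 _); rewrite subnKC.
- have NE q : N q = \prod_(k < q) nu k.
    elim: q => [|q IH]; first by rewrite big_ord0.
    by rewrite big_ord_recr/= -IH /nu mulrC divfK// gt_eqF.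
  move=> h h0; have [||e e0|C HC] := @prod_negligible (fun k => (b k)^-1) nu _ _ _ h h0.
  + by move=> k; rewrite invr_gt0.
  + exact: nu0.
  + have eB : 0 < e * B by rewrite mulr_gt0.
    have [n1 H1] := c3 _ eB.
    have e2 : 0 < e * B / lam by rewrite divr_gt0.
    (* the terms of a summable c are bounded, so 1 / nu = o(c) tends to 0 *)
    have [n2 H2] : exists n2, forall k, (n2 <= k)%N -> (nu (p + k)%N)^-1 <= e * B / lam.
      have cT : 0 < 2 * T + 1.
        have := c2 0%N; rewrite big_ord0; lra.
      have [n2 H2] := c3 (e * B / lam / (2 * T + 1)) (divr_gt0 e2 cT).
      exists n2 => k /H2 /le_trans; apply.
      rewrite -mulrA ler_piMr// ?(ltW e2)// mulrC ler_pdivrMr// mul1r.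
      have := c2 k.+1; rewrite big_ord_recr/=.
      have : 0 <= \sum_(i < k) c i by apply: sumr_ge0 => i _; exact: ltW.
      lra.
    exists (p + maxn n1 n2)%N => k kn.
    have pk : (p <= k)%N by apply: leq_trans kn; exact: leq_addr.
    have kE : (p + (k - p))%N = k by rewrite subnKC.
    have kn' : (maxn n1 n2 <= k - p)%N by rewrite leq_subRL.
    have := H1 (k - p)%N (leq_trans (leq_maxl _ _) kn').
    have := H2 (k - p)%N (leq_trans (leq_maxr _ _) kn').
    rewrite kE => h2 h1.
    have env : 0 < e * nu k by rewrite mulr_gt0.
    rewrite -[e * nu k]invrK lef_pV2 ?posrE ?invr_gt0//.
    rewrite /b ltnNge pk/= invfM.
    have -> : e^-1 / nu k = B * ((nu k)^-1 / (e * B)) by field; rewrite !gt_eqF.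
    rewrite ler_wpM2l ?(ltW B_gt0)// le_min !ler_pdivrMr// mulrC h2/=.
    by rewrite mulrC.
  + by exists C => q; rewrite NE.
Qed.

End Widths.
End WidthChoice.

(** * One term of the series *)

Section Terms.
Context {R : realType}.
Implicit Types (x y : R) (N : nat -> R) (F : nat -> R -> R).

Section Term.
Variables (N : nat -> R) (p : nat) (lam B T r : R).
Hypothesis N_gt0 : forall k, 0 < N k.
Hypothesis N0 : N 0%N = 1.
Let nu k := N k.+1 / N k.
Hypothesis lam_gt0 : 0 < lam.
Hypothesis B_gt0 : 0 < B.
Hypothesis lam_nu : forall k, (p <= k)%N -> lam <= nu k.
Hypothesis nuT : forall n, \sum_(k < n) (nu (p + k)%N)^-1 <= T.
Hypothesis r_ge : B * (p%:R / lam + 2 * T) <= r.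
Hypothesis r_gt0 : 0 < r.
Variables (M C s : R).
Hypothesis M_gt0 : 0 < M.
Hypothesis MN : forall q, (q <= p)%N -> M <= C * s ^+ p * N q * lam ^+ (p - q).

(** For q <= p this is the hypothesis M <= C s^p N_q lam^(p-q) rescaled by B; beyond
    p each further derivative multiplies the left side by at most nu_q / B, which is
    what the right side gains. *)
Lemma weight_bound (W : nat -> R) : W 0%N = 1 ->
  (forall k, 0 <= W k) ->
  (forall k, (k < p)%N -> W k.+1 = W k * (lam / B)) ->
  (forall k, (p <= k)%N -> W k.+1 <= W k * (nu k / B)) ->
  forall q, M * (B / lam) ^+ p * W q <= C * (s * B) ^+ p * B^-1 ^+ q * N q.
Proof.
move=> W0 Wge Wlt Wgt q.
have lB : 0 < lam / B by rewrite divr_gt0.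
have Wq k : (k <= p)%N -> W k = (lam / B) ^+ k.
  elim: k => [|k IH] kp; first by rewrite W0 expr0.
  by rewrite Wlt// IH ?(ltnW kp)// exprSr.
have low k : (k <= p)%N -> M * (B / lam) ^+ p * W k <= C * (s * B) ^+ p * B^-1 ^+ k * N k.
  move=> kp; rewrite Wq// -(subnK kp); set d := (p - k)%N.
  have -> : M * (B / lam) ^+ (d + k) * (lam / B) ^+ k = M * (B / lam) ^+ d.
    rewrite exprD -mulrA -(mulrA (_ ^+ d)) -exprMn.
    by rewrite (_ : B / lam * (lam / B) = 1) ?expr1n ?mulr1//; field; rewrite !gt_eqF.
  have -> : C * (s * B) ^+ (d + k) * B^-1 ^+ k * N k = C * s ^+ p * N k * B ^+ d.
    rewrite exprMn (exprD B) (subnK kp) exprVn.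
    by field; rewrite expf_neq0// gt_eqF.
  rewrite expr_div_n mulrA ler_pdivrMr ?exprn_gt0// mulrAC ler_wpM2r//.
    by rewrite exprn_ge0// ltW.
  exact: MN.
have [/low//|pq] := leqP q p.
rewrite -(subnKC (ltnW pq)); elim: (q - p)%N => [|d IH]; first by rewrite addn0; exact: low.
rewrite addnS; set k := (p + d)%N in IH *.
have pk : (p <= k)%N by exact: leq_addr.
have nB : 0 <= nu k / B by rewrite divr_ge0// ?ltW// divr_gt0.
apply: (@le_trans _ _ (M * (B / lam) ^+ p * (W k * (nu k / B)))).
  rewrite ler_wpM2l//; last exact: Wgt.
  by rewrite mulr_ge0// ?ltW// exprn_gt0// divr_gt0.
rewrite mulrA; apply: le_trans (ler_wpM2r nB IH) _.
rewrite exprS /nu le_eqVlt; apply/orP; left; apply/eqP; field.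
by rewrite !gt_eqF.
Qed.

(** The function x^p / p! cut off at radius 5 r.  In the Leibniz formula the factors
    (B / lam)^(p-i) from the monomial and prod_(k < j) 1 / b_k from the cut-off
    combine to at most (B / lam)^p prod_(k < i+j) 1 / b_k, because every 1 / b_k is at
    least lam / B; so the bound depends on the total order only. *)
Lemma term_exists (K : R) : 5 * r <= B * K * p.+1%:R / lam -> 0 <= K ->
  exists g : nat -> R -> R, [/\ tower g,
    forall q, g q 0 = (q == p)%:R,
    forall q x, 5 * r <= `|x| -> g q x = 0,
    forall q x, M * `|g q x| <=
      C * expR K * (s * expR K * B) ^+ p * (2 / B) ^+ q * N q
    & forall h, 0 < h -> exists D, forall q x, `|g q x| <= D * h ^+ q * N q].
Proof.
move=> rK K0.
have [b [bs b1 b2 b3 b4]] := widths_exist N_gt0 N0 lam_gt0 B_gt0 lam_nu nuT r_ge.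
have [chi [c1 c2 c3 c4]] := cutoff_exists r_gt0 bs.
have [b0 _] := bs.
pose W q := \prod_(k < q) (b k)^-1.
have W0 q : 0 < W q by apply: prodr_gt0 => k _; rewrite invr_gt0.
have WS q : W q.+1 = W q * (b q)^-1 by rewrite /W big_ord_recr.
have WD i j : (lam / B) ^+ i * W j <= W (i + j)%N.
  elim: i => [|i IH]; first by rewrite expr0 mul1r.
  rewrite addSn WS exprS -mulrA mulrC; apply: ler_pM => //.
    by rewrite mulr_ge0// ?ltW// exprn_gt0// divr_gt0.
  by rewrite ltW// divr_gt0.
have B0 : 0 < B / lam by rewrite divr_gt0.
pose g q := leibniz q (monomial p) chi.
have gb q x : `|g q x| <= 2 ^+ q * (expR K ^+ p.+1 * (B / lam) ^+ p * W q).
  apply: (@leibniz_bounded _ _ _ _ (fun q => expR K ^+ p.+1 * (B / lam) ^+ p * W q)) => i j.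
  have rhs0 : 0 <= expR K ^+ p.+1 * (B / lam) ^+ p * W (i + j)%N.
    by rewrite !mulr_ge0// ?exprn_ge0 ?expR_ge0// ltW.
  have [xr|xr] := leP (5 * r) `|x|; first by rewrite c3// mulr0 normr0.
  rewrite /monomial; case: leqP => ip; last by rewrite mul0r normr0.
  rewrite normrM normrM normfV (normr_nat R) normrX.
  set k := (p - i)%N.
  have h1 : `|x| ^+ k / k`!%:R <= expR K ^+ p.+1 * (B / lam) ^+ k.
    apply: (@le_trans _ _ ((K * p.+1%:R) ^+ k / k`!%:R * (B / lam) ^+ k)).
      rewrite mulrAC -exprMn ler_wpM2r ?invr_ge0//.
      apply: lerXn2r; rewrite ?nnegrE//.
        by rewrite mulr_ge0 ?(ltW B0)// mulr_ge0.
      apply: (le_trans (ltW xr)); apply: le_trans rK _.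
      by rewrite le_eqVlt; apply/orP; left; apply/eqP; ring.
    rewrite ler_wpM2r ?exprn_ge0 ?(ltW B0)// -expRM_natl [_ * K]mulrC.
    by rewrite expfact_le// mulr_ge0.
  apply: (@le_trans _ _ (expR K ^+ p.+1 * (B / lam) ^+ k * W j)).
    apply: ler_pM; rewrite ?normr_ge0 ?c4 ?h1 ?mulr_ge0 ?exprn_ge0 ?invr_ge0 ?ler0n//.

  rewrite -!mulrA ler_wpM2l ?exprn_ge0 ?expR_ge0//.
  have -> : (B / lam) ^+ k * W j = (B / lam) ^+ p * ((lam / B) ^+ i * W j).
    rewrite -(subnK ip) exprD -/k -mulrA; congr (_ * _); rewrite mulrA -exprMn.
    by rewrite (_ : B / lam * (lam / B) = 1) ?expr1n ?mul1r//; field; rewrite !gt_eqF.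
  by rewrite ler_wpM2l ?exprn_ge0 ?(ltW B0)// WD.
exists g; split.
- by apply: leibniz_tower => //; exact: monomial_tower.
- move=> q; rewrite /g leibniz_local_one ?monomial0//.
    by rewrite c2// normr0 ltW.
  by move=> n; rewrite c2// normr0 ltW.
- move=> q x xr; apply/eqP; rewrite -normr_le0 -(mulr0 (2 ^+ q)).
  apply: (@leibniz_bounded _ _ _ _ (fun=> 0)) => i j.
  by rewrite c3// mulr0 normr0.
- move=> q x.
  apply: (@le_trans _ _ (2 ^+ q * expR K ^+ p.+1 * (M * (B / lam) ^+ p * W q))).
    apply: le_trans (ler_wpM2l (ltW M_gt0) (gb q x)) _.
    by rewrite le_eqVlt; apply/orP; left; apply/eqP; ring.
  have := @weight_bound W _ _ _ _ q.
  move=> wb; apply: le_trans (ler_wpM2l _ (wb _ _ _ _)) _.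
  + by rewrite mulr_ge0 ?exprn_ge0 ?expR_ge0.
  + by rewrite /W big_ord0.
  + by move=> k; exact: ltW.
  + by move=> k kp; rewrite WS b1.
  + by move=> k pk; rewrite WS; apply: ler_wpM2l; [exact: ltW|exact: b3].
  + rewrite le_eqVlt; apply/orP; left; apply/eqP.
    by rewrite !exprMn exprS; ring.
- move=> h h0; have h2 : 0 < h / 2 by rewrite divr_gt0.
  have [D HD] := b4 _ h2.
  exists (expR K ^+ p.+1 * (B / lam) ^+ p * D) => q x.
  apply: (le_trans (gb q x)); rewrite mulrCA -!mulrA.
  rewrite ler_wpM2l ?exprn_ge0 ?expR_ge0// ler_wpM2l ?exprn_ge0 ?(ltW B0)//.
  apply: le_trans (ler_wpM2l _ (HD q)) _; first by rewrite exprn_ge0.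
  rewrite -/(W q) expr_div_n le_eqVlt; apply/orP; left; apply/eqP; field.
  by rewrite expf_neq0.
Qed.

End Term.
End Terms.

(** * Summation of the terms *)

Section Summation.
Context {R : realType}.
Implicit Types (x y : R) (N : nat -> R) (F : nat -> R -> R).

(** The values of h for which all terms but finitely many have type h. *)
Definition small_from (B : nat -> R) (h : R) := exists P, forall p, (P <= p)%N -> 2 / B p <= h.

(** The terms with index at least P are bounded by a common geometric series times
    h^q N_q; the finitely many others satisfy such a bound individually, with their
    own constants. *)
Lemma real_extension (N M lam B alpha : nat -> R) (A s Cm C beta : R) :
  (forall k, 0 < N k) -> N 0%N = 1 ->
  (forall p, 0 < M p) -> (forall p, 0 < lam p) -> (forall p, 0 < B p) ->
  0 <= A -> 0 <= Cm -> 0 <= C ->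
  (forall p k, (p <= k)%N -> lam p <= N k.+1 / N k) ->
  (forall p n, \sum_(k < n) (N (p + k).+1 / N (p + k)%N)^-1 <= A * p.+1%:R / lam p) ->
  (forall p q, (q <= p)%N -> M p <= Cm * s ^+ p * N q * lam p ^+ (p - q)) ->
  let K := 5 * (1 + 2 * A) in
  (forall p, B p * K * p.+1%:R <= lam p) ->
  (forall p, `|alpha p| * (s * expR K * B p) ^+ p <= C * 2^-1 ^+ p * M p) ->
  (forall p, 2 / B p <= beta) ->
  exists F, [/\ tower F, forall q, F q 0 = alpha q,
    forall q x, 1 <= `|x| -> F q x = 0
    & forall h, 0 < h -> small_from B h ->
        exists D, forall q x, `|F q x| <= D * h ^+ q * N q].
Proof.
move=> N_gt0 N0 M_gt0 lam_gt0 B_gt0 A0 Cm0 C0 lam_nu tail MN K rad alph Bbeta.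
have K0 : 0 < K by rewrite /K; lra.
pose r p := B p * (1 + 2 * A) * p.+1%:R / lam p.
have r_gt0 p : 0 < r p.
  by rewrite divr_gt0// mulr_gt0// mulr_gt0//; lra.
have r_ge p : B p * (p%:R / lam p + 2 * (A * p.+1%:R / lam p)) <= r p.
  have -> : r p = B p * (p.+1%:R / lam p + 2 * (A * p.+1%:R / lam p)).
    by rewrite /r; ring.
  rewrite ler_wpM2l ?(ltW (B_gt0 p))// lerD2r ler_wpM2r ?invr_ge0 ?(ltW (lam_gt0 p))//.
  by rewrite ler_nat.
have rK p : 5 * r p <= B p * K * p.+1%:R / lam p.
  by rewrite le_eqVlt; apply/orP; left; apply/eqP; rewrite /r /K; ring.
have r1 p : 5 * r p <= 1 by apply: le_trans (rK p) _; rewrite ler_pdivrMr// mul1r.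
have [g Hg] := choice (fun p => term_exists N_gt0 N0 (lam_gt0 p) (B_gt0 p) (lam_nu p)
  (tail p) (r_ge p) (r_gt0 p) (M_gt0 p) (MN p) (rK p) (ltW K0)).
pose D0 := C * Cm * expR K.
have D00 : 0 <= D0 by rewrite !mulr_ge0// expR_ge0.
have main p q x : `|alpha p * g p q x| <= D0 * 2^-1 ^+ p * (2 / B p) ^+ q * N q.
  have [_ _ _ gM _] := Hg p.
  rewrite normrM -(ler_pM2l (M_gt0 p)) mulrCA.
  apply: le_trans (ler_wpM2l _ (gM q x)) _ => //.
  have := alph p; set z := (s * _ * _) ^+ p.
  set w := (2 / B p) ^+ q.
  have w0 : 0 <= Cm * expR K * w * N q.
    by rewrite !mulr_ge0 ?expR_ge0// ?exprn_ge0 ?(ltW (N_gt0 q))// divr_ge0// ltW.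
  move=> H; have := ler_wpM2l w0 H.
  have -> : Cm * expR K * w * N q * (`|alpha p| * z) = `|alpha p| * (Cm * expR K * z * w * N q) by ring.
  move/le_trans; apply; rewrite le_eqVlt /D0; apply/orP; left; apply/eqP; ring.
have half n : \sum_(p < n) D0 * 2^-1 ^+ p <= D0 * 2.
  by rewrite -mulr_sumr ler_wpM2l// geometric_sum_le2.
have bound h P : 0 < h -> (forall p, (P <= p)%N -> 2 / B p <= h) ->
    exists d : nat -> R, (forall p q x, `|alpha p * g p q x| <= d p * h ^+ q * N q) /\
      exists S, forall n, \sum_(p < n) d p <= S.
  move=> h0 hP.
  have ex p : exists e : R, forall q x, `|alpha p * g p q x| <= e * h ^+ q * N q.
    have [_ _ _ _ gh] := Hg p; have [D HD] := gh h h0.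
    exists (`|alpha p| * D) => q x; rewrite normrM -!mulrA ler_wpM2l// mulrA.
    exact: HD.
  have [e He] := choice ex.
  pose d p := (if (p < P)%N then `|e p| else 0) + D0 * 2^-1 ^+ p.
  exists d; split.
    move=> p q x.
    have hN : 0 <= h ^+ q * N q by rewrite mulr_ge0 ?exprn_ge0 ?ltW.
    have D2 : 0 <= D0 * 2^-1 ^+ p by rewrite mulr_ge0// exprn_ge0// invr_ge0.
    rewrite -mulrA /d; have [pP|pP] := ltnP p P.
      apply: le_trans (He p q x) _; rewrite -mulrA ler_wpM2r//.
      by apply: le_trans (ler_norm _) _; rewrite lerDl.
    apply: le_trans (main p q x) _; rewrite add0r -mulrA ler_wpM2l//.
    rewrite ler_wpM2r ?(ltW (N_gt0 q))//.
    by apply: lerXn2r; rewrite ?nnegrE ?hP ?(ltW h0)// divr_ge0// ltW.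
  exists (\sum_(p < P) `|e p| + D0 * 2) => n.
  rewrite big_split/=; apply: lerD (half n).
  pose t p := if (p < P)%N then `|e p| else 0.
  apply: (@le_trans _ _ (\sum_(p < n + P) t p)).
    rewrite big_split_ord/= lerDl; apply: sumr_ge0 => p _.
    by rewrite /t; case: ifP.
  rewrite addnC big_split_ord/= [X in _ + X]big1 ?addr0.
    by apply: ler_sum => p _; rewrite /t ltn_ord.
  by move=> p _; rewrite /t ltnNge leq_addr.
have beta0 : 0 < beta by apply: lt_le_trans (Bbeta 0%N); rewrite divr_gt0.
have [d [Hd [S HS]]] := bound beta 0%N beta0 (fun p _ => Bbeta p).
pose Fp p q x := alpha p * g p q x.
have tF p : tower (Fp p).
  by move=> q x; apply: is_derive1Z; have [] := Hg p.
have sums h (d' : nat -> R) S' : 0 < h -> (forall n, \sum_(p < n) d' p <= S') ->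
    forall q n, \sum_(p < n) d' p * h ^+ q * N q <= S' * h ^+ q * N q.
  move=> h0 H q n; rewrite -!mulr_suml -!mulrA ler_wpM2r//.
  by rewrite mulr_ge0 ?exprn_ge0 ?ltW.
have limz q x l : (forall n, (q < n)%N -> \sum_(p < n) Fp p q x = l) ->
    series_tower Fp q x = l.
  move=> E; apply: cvg_lim => //; apply: cvg_near_cst.
  by exists q.+1 => // n /= qn; rewrite E.
exists (series_tower Fp); split.
- exact: (series_tower_tower tF Hd (sums beta d S beta0 HS)).
- move=> q; apply: limz => n qn.
  rewrite (bigD1 (Ordinal qn))//= big1 => [|p pq].
    by have [_ g0 _ _ _] := Hg q; rewrite /Fp g0 eqxx mulr1 addr0.
  have [_ g0 _ _ _] := Hg p; rewrite /Fp g0 eq_sym.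
  have -> : (p == q :> nat) = false by apply: contraNF pq => /eqP pq; apply/eqP/val_inj.
  by rewrite mulr0.
- move=> q x x1; apply: limz => n _; rewrite big1// => p _.
  have [_ _ gs _ _] := Hg p; rewrite /Fp gs ?mulr0//; exact: le_trans (r1 p) x1.
- move=> h h0 [P hP]; have [d' [Hd' [S' HS']]] := bound h P h0 hP.
  exists S' => q x.
  exact: (series_tower_bounded Hd' (sums h d' S' h0 HS')).
Qed.

(** The cut-off for p = 0 alone, which is of Beurling type. *)
Lemma bump_exists N (T r : R) : (forall k, 0 < N k) -> N 0%N = 1 ->
  (forall k, N 1%N <= N k.+1 / N k) ->
  (forall n, \sum_(k < n) (N k.+1 / N k)^-1 <= T) -> 0 < r ->
  exists F, [/\ tower F, F 0%N 0 != 0,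
    forall q x, r <= `|x| -> F q x = 0
    & forall h, 0 < h -> exists D, forall q x, `|F q x| <= D * h ^+ q * N q].
Proof.
move=> N_gt0 N0 N1 NT r0.
have T0 : 0 <= T by have := NT 0%N; rewrite big_ord0.
pose B := r / 5 / (1 + 2 * T).
have B0 : 0 < B by rewrite !divr_gt0//; lra.
have B2 : B * (0%:R / N 1%N + 2 * T) <= r / 5.
  rewrite mul0r add0r /B mulrAC ler_pdivrMr; last lra.
  rewrite ler_wpM2l//; last lra.
  by rewrite divr_ge0// ltW.
have r5 : 0 < r / 5 by rewrite divr_gt0.
have [b [bs _ _ _ b4]] := @widths_exist R N 0 (N 1%N) B T (r / 5) N_gt0 N0 (N_gt0 1%N) B0
  (fun k _ => N1 k) NT B2.
have [F [F1 F2 F3 F4]] := cutoff_exists r5 bs.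
exists F; split => //.
- by rewrite F2 ?oner_neq0// normr0 ltW.
- by move=> q x rx; rewrite F3// mulrC divfK.
- move=> h /b4[D HD]; exists D => q x; exact: le_trans (F4 q x) (HD q).
Qed.
End Summation.

(** * Consequences of the hypotheses on the weight sequences *)

Section WeightSequences.
Context {R : realType}.
Implicit Types (x y c : R) (M N : nat -> R).

Lemma ereal_sup_finite (S : set (\bar R)) : (ereal_sup S < +oo)%E ->
  exists2 c : R, 0 < c & forall z, S z -> (z <= c%:E)%E.
Proof.
move=> Soo.
have [c c0 Sc] : exists2 c : R, 0 < c & (ereal_sup S <= c%:E)%E.
  case: (ereal_sup S) Soo => [r _|//|_].
    exists (`|r| + 1); first by rewrite ltr_wpDl.
    by rewrite lee_fin (le_trans (ler_norm r))// lerDl.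
  by exists 1; rewrite ?leNye.
by exists c => // x Sx; apply: le_trans Sc; exact: ereal_sup_ubound.
Qed.

Lemma rootK x n : (0 < n)%N -> 0 <= x -> (x `^ (n%:R)^-1) ^+ n = x.
Proof.
move=> n0 x0; rewrite -powR_mulrn ?powR_ge0// -powRrM mulVf ?powRr1//.
by rewrite pnatr_eq0 -lt0n.
Qed.

Lemma root_le x y n : (0 < n)%N -> 0 <= x -> 0 <= y -> x <= y ^+ n -> x `^ (n%:R)^-1 <= y.
Proof.
move=> n0 x0 y0 xy; rewrite -(@ler_pXn2r _ n)// ?nnegrE ?powR_ge0//.
by rewrite rootK.
Qed.

Lemma preceq_le M N : (forall p, 0 < M p) -> (forall p, 0 < N p) -> preceq M N ->
  exists2 c, 0 < c & forall p, (0 < p)%N -> M p <= c ^+ p * N p.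
Proof.
move=> M0 N0 /ereal_sup_finite[c c0 H]; exists c => // p p0.
have : (((M p / N p) `^ (p%:R)^-1)%:E <= c%:E)%E by apply: H; exists p.
rewrite lee_fin => h; rewrite -ler_pdivrMr//.
rewrite -(@rootK (M p / N p) p)// ?divr_ge0 ?(ltW (M0 p)) ?(ltW (N0 p))//.
by apply: lerXn2r; rewrite ?nnegrE ?powR_ge0// ltW.
Qed.

Lemma LC_quotient N : LC N ->
  [/\ forall k, 0 < N k, N 0%N = 1, 1 <= N 1%N
    & forall m n, (m <= n)%N -> N m.+1 / N m <= N n.+1 / N n].
Proof.
move=> [N_gt0 [N0 N1] Nlc _]; split => // m n /subnK <-.
elim: (n - m)%N => // d IH; apply: le_trans IH _; rewrite addSn.
set k := (d + m)%N.
have := Nlc k.+1 isT; rewrite /= expr2 => h.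
by rewrite ler_pdivrMr// mulrAC ler_pdivlMr// [leRHS]mulrC.
Qed.

Lemma log_convex_ratio N : LC N ->
  forall k d j, (j + d <= k.+1)%N -> N (j + d)%N <= N j * (N k.+1 / N k) ^+ d.
Proof.
move=> /LC_quotient[N_gt0 _ _ nu_nd] k; elim=> [|d IH] j; first by rewrite addn0 expr0 mulr1.
rewrite addnS => jd; rewrite exprSr mulrA.
apply: (@le_trans _ _ (N (j + d)%N * (N (j + d).+1 / N (j + d)%N))).
  by rewrite mulrC divfK// gt_eqF.
apply: ler_pM; [exact: ltW|by rewrite ltW// divr_gt0|exact: IH (ltnW jd)|].
exact: nu_nd.
Qed.

Definition lamterm M N (p s j : nat) : R := (M p / (s%:R ^+ p * N j)) `^ ((p - j)%N%:R)^-1.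

Lemma lamterm_le_lambda M N p s j : (forall k, 0 < M k) -> (forall k, 0 < N k) ->
  (j < p)%N -> lamterm M N p s j <= lambdaMN M N p s.
Proof.
move=> M0 N0 jp; apply: ub_le_sup; last by exists j.
exists (\sum_(i < p) lamterm M N p s i) => _ [i /= ip <-].
rewrite (bigD1 (Ordinal ip))//= lerDl; apply: sumr_ge0 => k _; exact: powR_ge0.
Qed.

(** The parameter s is enlarged beyond the one of the condition (M,N)_SV, so that
    M_p <= s^p N_p.  This decreases lam_p, hence keeps the condition, and makes
    lam_p <= nu_p by log-convexity.  The constant Cm absorbs M_0, on which the
    relation between M and N gives no information, and A absorbs the index 0, where
    lam is set to 1. *)
Lemma SV_data M N : LC N -> (forall k, 0 < M k) -> preceq M N -> SV M N ->
  exists lam (A s Cm : R), [/\ forall p, 0 < lam p, [/\ 0 <= A, 0 < s & 1 <= Cm],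
    forall p k, (p <= k)%N -> lam p <= N k.+1 / N k,
    forall p n, \sum_(k < n) (N (p + k).+1 / N (p + k)%N)^-1 <= A * p.+1%:R / lam p
    & forall p q, (q <= p)%N -> M p <= Cm * s ^+ p * N q * lam p ^+ (p - q)].
Proof.
move=> LN M_gt0 pMN [s0 s0_ge1 svMN].
have [N_gt0 N0 N1 nu_nd] := LC_quotient LN.
have nu_gt0 k : 0 < N k.+1 / N k by rewrite divr_gt0.
have [c c0 Mc] := preceq_le M_gt0 N_gt0 pMN.
have [A0 A0_gt0 HA] := ereal_sup_finite svMN.
pose sn := (s0 + Num.bound c)%N; pose s : R := sn%:R.
have s00 : 0 < s0%:R :> R by rewrite ltr0n.
have s_gt0 : 0 < s by rewrite ltr0n addn_gt0 s0_ge1.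
have cs : c <= s.
  by rewrite (le_trans (ltW (archi_boundP (ltW c0))))// ler_nat leq_addl.
have s0s : s0%:R <= s by rewrite ler_nat leq_addr.
pose l0 p := lambdaMN M N p s0.
pose lam p := if p is 0 then 1 else lambdaMN M N p sn.
have arg_gt0 p j t : 0 < t -> 0 < M p / (t ^+ p * N j).
  by move=> t0; rewrite divr_gt0// mulr_gt0// exprn_gt0.
have term_gt0 p j (t : nat) : (0 < t)%N -> 0 < lamterm M N p t j.
  by move=> t0; rewrite powR_gt0// arg_gt0// ltr0n.
have sn0 : (0 < sn)%N by rewrite addn_gt0 s0_ge1.
have lam_gt0 p : 0 < lam p.
  case: p => [|p]//=; apply: lt_le_trans (lamterm_le_lambda sn M_gt0 N_gt0 (ltn0Sn p)).
  exact: term_gt0.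
have l0_gt0 p : 0 < l0 p.+1.
  apply: lt_le_trans (lamterm_le_lambda s0 M_gt0 N_gt0 (ltn0Sn p)).
  exact: term_gt0.
have lam_l0 p : lam p.+1 <= l0 p.+1.
  apply: ge_sup; first by exists (lamterm M N p.+1 sn 0%N), 0%N.
  move=> _ [j /= jp <-]; apply: le_trans (lamterm_le_lambda s0 M_gt0 N_gt0 jp).
  apply: ge0_ler_powR; rewrite ?invr_ge0// ?nnegrE ?(ltW (arg_gt0 _ _ _ _))//.
  rewrite ler_pM2l// lef_pV2 ?posrE ?mulr_gt0 ?exprn_gt0//.
  rewrite ler_pM2r//; apply: lerXn2r; rewrite ?nnegrE// ltW.
have Ms p : (0 < p)%N -> M p <= s ^+ p * N p.
  move=> p0; apply: le_trans (Mc p p0) _; rewrite ler_pM2r//.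
  by apply: lerXn2r; rewrite ?nnegrE// ltW.
have lam_nu p k : (p <= k)%N -> lam p <= N k.+1 / N k.
  case: p => [|p] pk; last first.
    apply: le_trans (nu_nd p k (ltnW pk)).
    apply: ge_sup; first by exists (lamterm M N p.+1 sn 0%N), 0%N.
    move=> _ [j /= jp <-].
    have d0 : (0 < p.+1 - j)%N by rewrite subn_gt0.
    apply: root_le; rewrite ?(ltW (nu_gt0 _)) ?(ltW (arg_gt0 _ _ _ _))//.
    rewrite ler_pdivrMr ?mulr_gt0 ?exprn_gt0// mulrC -mulrA.
    apply: le_trans (Ms _ (ltn0Sn p)) _; rewrite ler_pM2l ?exprn_gt0//.
    have := @log_convex_ratio N LN p (p.+1 - j) j.
    by rewrite subnKC ?(ltnW jp)//; apply.
  by apply: le_trans (nu_nd _ _ (leq0n k)); rewrite N0 divr1.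
have tail p n : (0 < p)%N -> l0 p / p%:R * \sum_(k < n) (N (p.-1 + k).+1 / N (p.-1 + k)%N)^-1 <= A0.
  case: p => // p _; rewrite -lee_fin.
  apply: le_trans (HA _ (ex_intro2 _ _ p.+1 isT erefl)).
  rewrite EFinM; apply: lee_wpmul2l; first by rewrite lee_fin divr_ge0// ltW.
  apply: le_trans (@nneseries_lim_ge R _ xpredT p.+1 (p.+1 + n)%N _).
    have -> : \sum_(p.+1 <= i < p.+1 + n) ((quotseq N i)^-1)%:E =
        (\sum_(k < n) (N (p + k).+1 / N (p + k)%N)^-1)%:E :> \bar R.
      elim: n => [|n IH]; first by rewrite addn0 big_geq// big_ord0.
      by rewrite addnS big_nat_recr ?leq_addr//= IH big_ord_recr/= EFinD.
    exact: lexx.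
  move=> k _ _; rewrite lee_fin invr_ge0; case: k => [|k]//=.
  exact: ltW.
exists lam, (A0 + A0 / l0 1%N), s, (1 + M 0%N); split => //.
- split => //; first by rewrite addr_ge0// ltW// divr_gt0.
  by rewrite lerDl ltW.
- case=> [|p] n.
    have := tail 1%N n isT; rewrite divr1 /= -ler_pdivlMl// mulr1 divr1.
    by rewrite mulrC => /le_trans; apply; rewrite lerDr ltW.
  apply: (@le_trans _ _ (\sum_(k < n.+1) (N (p + k).+1 / N (p + k)%N)^-1)).
    rewrite big_ord_recl/= [leRHS]addrC -[leLHS]addr0; apply: lerD; last by rewrite invr_ge0 ltW.
    by apply: ler_sum => k _; rewrite /bump/= ?addSn ?add1n ?addnS ?lexx.
  have := tail p.+1 n.+1 isT; rewrite /= -ler_pdivlMl ?divr_gt0// => /le_trans; apply.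
  rewrite invf_div mulrC -mulrA.
  apply: ler_pM.
  + exact: ltW.
  + by rewrite divr_ge0// ltW.
  + by rewrite lerDl ltW// divr_gt0.
  + apply: ler_pM; rewrite ?invr_ge0 ?(ltW (l0_gt0 _))// ?ler_nat//.
    have h : (l0 p.+1)^-1 <= (lam p.+1)^-1 by rewrite lef_pV2 ?posrE ?l0_gt0 ?lam_gt0 ?lam_l0.
    exact: h.
- move=> p q qp.
  have Cm1 : 1 <= 1 + M 0%N by rewrite lerDl ltW.
  case: (posnP p) qp => [->|p0] qp.
    by move: qp; rewrite leqn0 => /eqP ->; rewrite !expr0 N0 !mulr1 lerDr.
  apply: (@le_trans _ _ (s ^+ p * N q * lam p ^+ (p - q))); last first.
    rewrite -!mulrA ler_peMl// !mulr_ge0 ?exprn_ge0// ltW//.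
  move: qp; rewrite leq_eqVlt => /orP[/eqP ->|qp].
    by rewrite subnn expr0 mulr1 Ms.
  case: p p0 qp => // p _ qp.
  have d0 : (0 < p.+1 - q)%N by rewrite subn_gt0.
  rewrite mulrC -ler_pdivrMr ?mulr_gt0 ?exprn_gt0//.
  rewrite -[leLHS](rootK d0) ?(ltW (arg_gt0 _ _ _ _))//.
  apply: lerXn2r; rewrite ?nnegrE ?powR_ge0 ?(ltW (lam_gt0 _))//.
  exact: lamterm_le_lambda.
Qed.

End WeightSequences.

(** * Choice of the radii *)

Section RadiusChoice.
Context {R : realType}.
Implicit Types (x y c : R) (M N : nat -> R).

Lemma positive_lower_bound (l : nat -> R) c P : (forall p, 0 < l p) -> 0 < c ->
  (forall p, (P <= p)%N -> c <= l p) -> exists2 e, 0 < e & forall p, e <= l p.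
Proof.
move=> l0; elim: P c => [|P IH] c c0 H; first by exists c => // p; exact: H.
apply: (IH (Num.min c (l P))); first by rewrite lt_min c0 l0.
move=> p; rewrite leq_eqVlt => /orP[/eqP <-|/H]; rewrite ge_min ?lexx ?orbT//.
by move=> ->.
Qed.

(** Taking q = 0 in M_p <= Cm s^p N_q lam_p^(p-q) bounds lam_p from below by
    M_p^(1/p), and p! >= (p / e)^p. *)
Lemma rootfact_growth M (lam : nat -> R) (s Cm : R) : (forall p, 0 < M p) ->
  (forall p, 0 < lam p) -> 0 < s -> 1 <= Cm ->
  (forall p, M p <= Cm * s ^+ p * lam p ^+ p) ->
  exists2 kappa, 0 < kappa & forall p c, (0 < p)%N -> 0 <= c -> c <= rootfact M p ->
    c * kappa * p.+1%:R <= lam p.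
Proof.
move=> M0 lam0 s0 Cm1 H.
have Cm0 : 0 < Cm by apply: lt_le_trans Cm1.
have E0 : 0 < expR 1 * s * Cm by rewrite !mulr_gt0// expR_gt0.
exists ((2 * (expR 1 * s * Cm))^-1); first by rewrite invr_gt0 mulr_gt0.
move=> p c p0 c0 cM.
have f0 : 0 < p`!%:R :> R by rewrite ltr0n fact_gt0.
have Mc : c ^+ p * p`!%:R <= M p.
  rewrite -ler_pdivlMr// -(rootK p0 (ltW (divr_gt0 (M0 p) f0))).
  by apply: lerXn2r; rewrite ?nnegrE ?powR_ge0.
have pf : p%:R ^+ p <= expR 1 ^+ p * p`!%:R :> R.
  by rewrite -ler_pdivrMr// -expRM_natl mulr1 expfact_le.
have : (c * p%:R) ^+ p <= (expR 1 * s * Cm * lam p) ^+ p.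
  apply: (@le_trans _ _ (expR 1 ^+ p * M p)).
    rewrite exprMn; apply: le_trans (ler_wpM2l (exprn_ge0 _ c0) pf) _.
    by rewrite mulrCA ler_wpM2l// exprn_ge0// expR_ge0.
  rewrite -!mulrA exprMn ler_wpM2l ?exprn_ge0 ?expR_ge0//.
  apply: le_trans (H p) _; rewrite !exprMn -mulrA [leLHS]mulrCA ler_wpM2l ?exprn_ge0 ?(ltW s0)//.
  by rewrite ler_wpM2r ?exprn_ge0 ?(ltW (lam0 p))// ler_eXnr.
rewrite ler_pXn2r ?nnegrE ?mulr_ge0 ?(ltW (lam0 p)) ?(ltW s0) ?(ltW Cm0) ?expR_ge0//.
move=> h; rewrite mulrAC ler_pdivrMr ?mulr_gt0//.
have -> : lam p * (2 * (expR 1 * s * Cm)) = 2 * (expR 1 * s * Cm * lam p) by ring.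
apply: (@le_trans _ _ (2 * (c * p%:R))); last by rewrite ler_pM2l.
rewrite mulrCA ler_wpM2l//.
by rewrite -natrM ler_nat mul2n -addnn -addn1 leq_add2l.
Qed.

Lemma limn_einf_gt0 (u : nat -> R) : (0 < limn_einf (fun p => (u p)%:E))%E ->
  exists c P, 0 < c /\ forall p, (P <= p)%N -> c <= u p.
Proof.
rewrite limn_einf_lim (cvg_lim _ (@cvg_einfs_sup _ _))//.
move=> /ereal_sup_gt[_ [P _ <-]]; rewrite /einfs /=; set e := ereal_inf _ => e0.
have el p : (P <= p)%N -> (e <= (u p)%:E)%E.
  by move=> Pp; apply: ereal_inf_lbound; exists p.
case: e e0 el => [r r0 el|_ el|//].
  by exists r, P; split => // p /el; rewrite lee_fin.
by have := el P (leqnn P).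
Qed.

Lemma Lambda_hP M h (a : nat -> R[i]) : (forall p, 0 < M p) -> 0 < h -> Lambda_h M h a ->
  exists2 C, 0 < C & forall p, Normc.normc (a p) <= C * h ^+ p * M p.
Proof.
move=> M0 h0 /ereal_sup_finite[C C0 H]; exists C => // p.
rewrite -mulrA -ler_pdivrMr ?mulr_gt0 ?exprn_gt0//.
by have := H _ (ex_intro2 _ _ p I erefl); rewrite lee_fin.
Qed.

Section Radii.
Variables (M lam n : nat -> R) (s Cm K L : R).
Hypotheses (M_gt0 : forall p, 0 < M p) (lam_gt0 : forall p, 0 < lam p).
Hypotheses (s_gt0 : 0 < s) (Cm_ge1 : 1 <= Cm) (K_gt0 : 0 < K) (L_gt0 : 0 < L).
Hypothesis Mlam : forall p, M p <= Cm * s ^+ p * lam p ^+ p.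
Hypothesis n_ge0 : forall p, 0 <= n p.

(** The requirements on the parameters B_p: the support of each term lies in
    [-1, 1], the coefficients n_p are summable against the constants of the terms,
    and the types 2 / B_p are bounded. *)
Definition radii (B : nat -> R) (C beta : R) := [/\ forall p, 0 < B p, 0 < C,
  forall p, B p * K * p.+1%:R <= lam p,
  forall p, n p * (L * B p) ^+ p <= C * 2^-1 ^+ p * M p
  & forall p, 2 / B p <= beta].

(** A constant B suffices: lam_p / (p + 1) is bounded below, and n_p / M_p is at most
    geometric. *)
Lemma radii_roumieu : (0 < limn_einf (fun p => (rootfact M p)%:E))%E ->
  (exists2 h, 0 < h & exists2 C, 0 < C & forall p, n p <= C * h ^+ p * M p) ->
  exists B C beta, radii B C beta.
Proof.
move=> /limn_einf_gt0[c [P [c0 HP]]] [h h0 [C C0 nC]].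
have [kappa k0 Hk] := rootfact_growth M_gt0 lam_gt0 s_gt0 Cm_ge1 Mlam.
have [e e0 He] : exists2 e, 0 < e & forall p, e <= lam p / p.+1%:R.
  apply: (@positive_lower_bound (fun p => lam p / p.+1%:R) (c * kappa) P.+1).
  - by move=> p; rewrite divr_gt0.
  - by rewrite mulr_gt0.
  - move=> p Pp; rewrite ler_pdivlMr//; apply: Hk (ltW c0) (HP _ _).
      exact: leq_trans Pp.
    exact: ltnW.
pose b := Num.min (e / K) ((2 * h * L)^-1).
have b0 : 0 < b by rewrite lt_min divr_gt0//= invr_gt0 !mulr_gt0.
exists (fun=> b), C, (2 / b); split => //.
- move=> p; rewrite -ler_pdivlMr//; apply: le_trans (He p).
  by rewrite -ler_pdivlMr// ge_min lexx.
- move=> p.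
  have Lb : L * b <= (2 * h)^-1.
    have -> : (2 * h)^-1 = L * (2 * h * L)^-1 by field; rewrite !gt_eqF.
    by rewrite ler_pM2l// ge_min lexx orbT.
  apply: (@le_trans _ _ (C * h ^+ p * M p * (2 * h)^-1 ^+ p)).
    apply: ler_pM => //; first by rewrite exprn_ge0// ltW// mulr_gt0.
    apply: lerXn2r => //; rewrite nnegrE ltW// ?mulr_gt0// invr_gt0 mulr_gt0//.
  rewrite invfM exprMn le_eqVlt; apply/orP; left; apply/eqP.
  by rewrite (exprVn h); field; rewrite expf_neq0// gt_eqF.
Qed.

(** B_p is the smaller of lam_p / (K (p + 1)) and 1 / (2 L (d_p + 1 / (p + 1))), where
    d_p = (n_p / M_p)^(1/p) tends to 0; the term 1 / (p + 1) avoids a division by 0.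
    Both tend to infinity. *)
Lemma radii_beurling : rootfact M p @[p --> \oo] --> +oo ->
  (forall h, 0 < h -> exists2 C, 0 < C & forall p, n p <= C * h ^+ p * M p) ->
  exists B C beta, radii B C beta /\ forall h, 0 < h -> small_from B h.
Proof.
move=> Moo nM.
have [kappa k0 Hk] := rootfact_growth M_gt0 lam_gt0 s_gt0 Cm_ge1 Mlam.
pose d p := (n p / M p) `^ (p%:R)^-1.
have d_ge0 p : 0 <= d p by exact: powR_ge0.
pose t p := d p + p.+1%:R^-1.
have t0 p : 0 < t p by rewrite ltr_wpDl// invr_gt0.
pose B p := Num.min (lam p / (K * p.+1%:R)) ((2 * L * t p)^-1).
have B0 p : 0 < B p.
  by rewrite lt_min divr_gt0 ?mulr_gt0//= invr_gt0 !mulr_gt0.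
have Bsmall h : 0 < h -> small_from B h.
  move=> h0.
  have h2 : 0 < 2 / h by rewrite divr_gt0.
  have [P1 _ HP1] : \forall p \near \oo, 2 / h * K / kappa <= rootfact M p.
    by move/cvgryPge : Moo; apply.
  pose u := h / (8 * L); have u0 : 0 < u by rewrite divr_gt0// mulr_gt0.
  have u2 : 0 < u / 2 by rewrite divr_gt0.
  have [C C0 HC] := nM _ u2.
  pose P2 := Num.bound C; pose P3 := Num.bound u^-1.
  exists (maxn (maxn P1 1) (maxn P2 P3)) => p.
  rewrite !geq_max => /andP[/andP[p1 p0] /andP[p2 p3]].
  rewrite ler_pdivrMr// mulrC -ler_pdivrMr// le_min; apply/andP; split.
    rewrite ler_pdivlMr ?mulr_gt0//.
    have q0 : 0 <= 2 / h * K / kappa by rewrite !mulr_ge0 ?invr_ge0// ltW.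
    apply: le_trans (Hk p _ p0 q0 (HP1 p p1)).
    rewrite le_eqVlt; apply/orP; left; apply/eqP; field.
    by rewrite !gt_eqF.
  have du : d p <= u.
    apply: root_le => //; [by rewrite divr_ge0// ltW|exact: ltW|].
    rewrite ler_pdivrMr//; apply: le_trans (HC p) _.
    rewrite ler_pM2r// expr_div_n mulrCA -[leRHS]mulr1 ler_pM2l ?exprn_gt0//.
    rewrite ler_pdivrMr ?exprn_gt0// mul1r.
    by apply: ltW; apply: upper_nthrootP.
  have pu : p.+1%:R^-1 <= u.
    rewrite -[u]invrK lef_pV2 ?posrE ?invr_gt0//.
    apply: (le_trans (ltW (archi_boundP (ltW _)))); first by rewrite invr_gt0.
    by rewrite ler_nat; apply: leq_trans p3 _.
  have tL : 0 < 2 * L * t p by rewrite !mulr_gt0.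
  rewrite -[leLHS]invrK lef_pV2 ?posrE ?invr_gt0// invf_div.
  apply: (@le_trans _ _ (2 * L * (u + u))).
    by rewrite ler_pM2l ?mulr_gt0// lerD.
  by rewrite le_eqVlt /u; apply/orP; left; apply/eqP; field; rewrite gt_eqF.
have [e e0 He] : exists2 e, 0 < e & forall p, e <= B p.
  have [P HP] := Bsmall 2 (ltr0n _ 2); apply: (@positive_lower_bound B 1 P) => // p /HP.
  by rewrite ler_pdivrMr// -{1}[2]mulr1 ler_pM2l.
exists B, (1 + n 0%N / M 0%N), (2 / e); split => //; split => //.
- by rewrite ltr_pwDl// divr_ge0// ltW.
- move=> p; rewrite -mulrA -ler_pdivlMr ?mulr_gt0//.
  by rewrite ge_min lexx.
- case=> [|p].
    rewrite !expr0 !mulr1 mulrDl mul1r divfK ?gt_eqF// lerDr ltW//.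
  have C1 : 1 <= 1 + n 0%N / M 0%N by rewrite lerDl divr_ge0// ltW.
  have nE : n p.+1 = d p.+1 ^+ p.+1 * M p.+1.
    by rewrite rootK ?divr_ge0 ?(ltW (M_gt0 _))// divfK// gt_eqF.
  rewrite nE mulrAC ler_pM2r//.
  apply: (@le_trans _ _ (2^-1 ^+ p.+1)); last first.
    by rewrite ler_peMl// exprn_ge0// invr_ge0.
  rewrite -exprMn; apply: lerXn2r; rewrite ?nnegrE ?invr_ge0 ?mulr_ge0 ?(ltW (B0 _)) ?(ltW L_gt0)//.
  apply: (@le_trans _ _ (t p.+1 * (L * (2 * L * t p.+1)^-1))).
    apply: ler_pM => //; first by rewrite mulr_ge0 ?(ltW (B0 _)) ?(ltW L_gt0).
      by rewrite lerDl invr_ge0.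
    by rewrite ler_pM2l// ge_min lexx orbT.
  by rewrite le_eqVlt; apply/orP; left; apply/eqP; field; rewrite !gt_eqF.
- by move=> p; rewrite ler_pM2l// lef_pV2 ?posrE.
Qed.

End Radii.
End RadiusChoice.

(** * Complex functions, flat perturbations and dimension *)

Section FlatPerturbations.
Context {R : realType}.
Implicit Types (x y c : R) (M N : nat -> R).

Lemma normc_le (x y : R) : Normc.normc (x +i* y)%C <= `|x| + `|y|.
Proof.
rewrite /Normc.normc -(@ler_pXn2r _ 2)// ?nnegrE ?sqrtr_ge0 ?addr_ge0//.
rewrite sqr_sqrtr ?addr_ge0 ?sqr_ge0//.
rewrite -(real_normK (num_real x)) -(real_normK (num_real y)).
rewrite sqrrD lerD2r lerDl mulrn_wge0// mulr_ge0//.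
Qed.

Lemma normc_ge_Re (z : R[i]) : `|complex.Re z| <= Normc.normc z.
Proof.
case: z => x y /=; rewrite -(sqrtr_sqr x) ler_wsqrtr// lerDl sqr_ge0//.
Qed.

Lemma normc_ge_Im (z : R[i]) : `|complex.Im z| <= Normc.normc z.
Proof.
case: z => x y /=; rewrite -(sqrtr_sqr y) ler_wsqrtr// lerDr sqr_ge0//.
Qed.

Definition bounded_by (N : nat -> R) (h : R) (F : nat -> R -> R) :=
  exists D, forall q x, `|F q x| <= D * h ^+ q * N q.

(** Smooth functions supported in [-1, 1] with Taylor coefficients a at 0 and with
    type h with respect to N for all h in H.  H is a single value in the Roumieu
    case and all positive reals in the Beurling case. *)
Definition jet_function (H : set R) N (a : nat -> R[i]) (f : R -> R[i]^o) :=
  exists F G : nat -> R -> R, [/\ tower F /\ tower G,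
    forall x, f x = (F 0%N x +i* G 0%N x)%C,
    forall q, (F q 0 +i* G q 0)%C = a q,
    forall q x, 1 <= `|x| -> F q x = 0 /\ G q x = 0
    & forall h, H h -> bounded_by N h F /\ bounded_by N h G].

Lemma jet_functionP (H : set R) N a f h : (forall k, 0 < N k) ->
  jet_function H N a f -> H h -> 0 < h -> D_h N h f /\ borel_map f = a.
Proof.
move=> N_gt0 [F [G [[tF tG] fE ja supp bd]]] Hh h0.
have dF n : derive1n n (fun t => complex.Re (f t)) = F n.
  rewrite -(tower_derive1n n tF); congr (derive1n n _).
  by apply/funext => t; rewrite fE.
have dG n : derive1n n (fun t => complex.Im (f t)) = G n.
  rewrite -(tower_derive1n n tG); congr (derive1n n _).
  by apply/funext => t; rewrite fE.
split; last by apply/funext => q; rewrite /borel_map /cderiv dF dG ja.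
split.
- move=> n x; rewrite dF dG; split.
    by have [] := tF n x.
  by have [] := tG n x.
- have cl : closed (`[-1, 1]%classic : set R) by exact: interval_closed.
  rewrite ((closure_id _).1 cl); apply: closure_subset => x /= /eqP fx.
  rewrite in_itv /= -ler_norml leNgt; apply/negP => /ltW x1; apply: fx.
  by rewrite fE; have [-> ->] := supp 0%N x x1.
- have [[D1 H1] [D2 H2]] := bd h Hh.
  apply: (@le_lt_trans _ _ (D1 + D2)%:E); last exact: ltry.
  apply: ge_ereal_sup => _ [p _ [x _ <-]].
  rewrite lee_fin ler_pdivrMr ?mulr_gt0 ?exprn_gt0// mulrDl !mulrA /cderiv dF dG.
  by apply: le_trans (normc_le _ _) _; apply: lerD.
Qed.

Lemma tower_linear (F G : nat -> R -> R) (c d : R) : tower F -> tower G ->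
  tower (fun q x => c * F q x + d * G q x).
Proof. by move=> tF tG q x; apply: is_derive1D; apply: is_derive1Z. Qed.

Lemma bounded_by_linear N h (F G : nat -> R -> R) (c d : R) :
  bounded_by N h F -> bounded_by N h G ->
  bounded_by N h (fun q x => c * F q x + d * G q x).
Proof.
move=> [D1 H1] [D2 H2]; exists (`|c| * D1 + `|d| * D2) => q x.
rewrite !mulrDl -!mulrA; apply: le_trans (ler_normD _ _) _; rewrite !normrM.
by apply: lerD; rewrite ler_wpM2l// mulrA.
Qed.

Lemma tower_add (F G : nat -> R -> R) : tower F -> tower G ->
  tower (fun q x => F q x + G q x).
Proof. by move=> tF tG q x; apply: is_derive1D. Qed.

Lemma bounded_by_add N h (F G : nat -> R -> R) :
  bounded_by N h F -> bounded_by N h G -> bounded_by N h (fun q x => F q x + G q x).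
Proof.
move=> [D1 H1] [D2 H2]; exists (D1 + D2) => q x.
by rewrite !mulrDl; apply: le_trans (ler_normD _ _) _; apply: lerD.
Qed.

Lemma jet_function_linear (H : set R) N a b f g (c : R[i]) :
  jet_function H N a f -> jet_function H N b g ->
  jet_function H N (fun q => c * a q + b q) (c *: f + g).
Proof.
move=> [F [G [[tF tG] fE ja sf bf]]] [F' [G' [[tF' tG'] gE jb sg bg]]].
case: c => c d.
exists (fun q x => (c * F q x + (- d) * G q x) + F' q x),
  (fun q x => (c * G q x + d * F q x) + G' q x); split.
- by split; apply: tower_add => //; exact: tower_linear.
- move=> x; have -> : ((c +i* d)%C *: f + g) x = (c +i* d)%C * f x + g x by [].
  by rewrite fE gE mulNr.
- by move=> q; rewrite -ja -jb mulNr.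
- by move=> q x x1; have [-> ->] := sf q x x1; have [-> ->] := sg q x x1; rewrite !mulr0 !addr0.
- move=> h Hh; have [bF bG] := bf h Hh; have [bF' bG'] := bg h Hh.
  by split; apply: bounded_by_add => //; exact: bounded_by_linear.
Qed.

Section Bump.
Variables (N : nat -> R) (phi : nat -> R -> R).
Hypothesis t_phi : tower phi.
Hypothesis phi_neq0 : phi 0%N 0 != 0.
Hypothesis phi_supp : forall q x, 4^-1 <= `|x| -> phi q x = 0.
Hypothesis phi_bd : forall h, 0 < h -> bounded_by N h phi.

Definition translate (c : R) : R -> R[i]^o := fun x => (phi 0%N (x - c) +i* 0)%C.

(** An injection of the real line into (3/8, 5/8): a bump of radius 1/4 centred there
    vanishes at 0 and lies in [-1, 1]. *)
Definition squash (t : R) := 5 / 8 - 4^-1 / (1 + expR t).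

Lemma squash_range t : 3 / 8 < squash t < 5 / 8.
Proof.
have e0 := expR_gt0 t; rewrite /squash.
have h1 : 4^-1 / (1 + expR t) < 4^-1 :> R by rewrite ltr_pdivrMr; lra.
have h2 : 0 < 4^-1 / (1 + expR t) :> R by rewrite divr_gt0//; lra.
lra.
Qed.

Lemma squash_inj : injective squash.
Proof.
move=> s t /addrI/oppr_inj/mulfI; rewrite invr_eq0 pnatr_eq0 => /(_ isT)/invr_inj/addrI.
exact: expR_inj.
Qed.

(** The infimum of the support of phi is approached by points of the support, and phi
    vanishes to its left. *)
Lemma support_edge (e : R) : 0 < e ->
  exists2 z, phi 0%N z != 0 & forall y, y <= z - e -> phi 0%N y = 0.
Proof.
move=> e0; pose S := [set z | phi 0%N z != 0].
have Slb : lbound S (- 4^-1).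
  move=> z /= /eqP pz; rewrite leNgt; apply/negP => z4; apply: pz.
  by apply: phi_supp; rewrite ler0_norm; lra.
have hS : has_inf S by split; [exists 0|exists (- 4^-1)].
have [z Sz zlt] := inf_adherent e0 hS; exists z => // y yz.
apply/eqP; apply: contraT => /= Sy.
have : inf S <= y by apply: ge_inf => //; exists (- 4^-1).
lra.
Qed.

Lemma translate_inj : injective (translate \o squash).
Proof.
suff H c d : c < d -> translate c <> translate d.
  move=> s t /= E; apply: squash_inj; apply/eqP; rewrite eq_le !leNgt.
  by apply/andP; split; apply/negP => /H; rewrite E.
move=> cd E; have [z pz zE] := @support_edge (d - c) (ltac:(lra)).
have := congr1 (fun u => complex.Re (u (c + z))) E; rewrite /translate /= addrC addKr.
rewrite (zE (c + z - d)); last lra.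
by move/eqP; rewrite (negbTE pz).
Qed.

Definition bumps := range (translate \o squash).

Lemma bumps_card : (bumps #= [set: R])%card.
Proof. by apply: inj_card_eq => s t _ _; exact: translate_inj. Qed.

(** Among the translates with nonzero coefficient take the leftmost one, and a point
    of its support closer to the left edge than the gap to the next translate: all
    the other terms vanish there. *)
Lemma bumps_independent : linearly_independent bumps.
Proof.
move=> n b c b_inj bB sum0 i; apply/eqP; apply: contraT => ci.
have /choice[t bt] : forall j, exists t, b j = translate (squash t).
  by move=> j; have [t _ <-] := bB j; exists t.
pose s j := squash (t j).
have s_inj j k : s j = s k -> j = k by move=> E; apply: b_inj; rewrite !bt -/(s j) E.
have [m cm mmin] := arg_minP s (P := fun j => c j != 0) ci.
pose e := \big[Order.min/1]_(j < n | (c j != 0) && (j != m)) (s j - s m).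
have e0 : 0 < e.
  rewrite /e; apply: lt_bigmin => // j /andP[cj jm].
  rewrite subr_gt0 lt_neqAle mmin// andbT; apply: contra jm => /eqP E.
  by apply/eqP/s_inj.
have [z pz zE] := support_edge e0.
have := congr1 (fun u => u (s m + z)) sum0.
have -> : (\sum_(j < n) c j *: b j) (s m + z) = \sum_(j < n) c j * b j (s m + z).
  by elim/big_ind2 : _ => // f y g w <- <-.
rewrite (bigD1 m)//= big1 ?addr0.
  rewrite bt -/(s m) /translate (addrC (s m)) addrK => /eqP.
  rewrite mulf_eq0 (negbTE cm)/=.
  by rewrite eq_complex/= eqxx andbT (negbTE pz).
move=> j jm; have [->|cj] := eqVneq (c j) 0; first by rewrite mul0r.
rewrite bt -/(s j) /translate zE ?mulr0//.
have : e <= s j - s m by apply: bigmin_le_cond; rewrite cj.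
lra.
Qed.

Lemma span_subspace (B : set (R -> R[i]^o)) : linear_subspace (linear_span B).
Proof.
split.
  exists 0%N, (fun _ => 0), (fun _ => 0); split; last by rewrite big_ord0.
  by case.
move=> k u v [n [b [c [bB ->]]]] [m [b' [c' [bB' ->]]]].
exists (n + m)%N, (fun i => match fintype.split i with inl j => b j | inr j => b' j end),
  (fun i => match fintype.split i with inl j => k * c j | inr j => c' j end); split.
  by move=> i; case: (fintype.split i).
rewrite big_split_ord/= scaler_sumr; congr (_ + _); apply: eq_bigr => i _.
  by rewrite scalerA (unsplitK (inl i)).
by rewrite (unsplitK (inr i)).
Qed.

Lemma jet_function_bumps f : linear_span bumps f ->
  jet_function [set h | 0 < h] N (fun=> 0) f.
Proof.
move=> [n [b [c [bB ->]]]].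
have z0 : jet_function [set h | 0 < h] N (fun=> 0) (0 : R -> R[i]^o).
  exists (fun _ _ => 0), (fun _ _ => 0); split => //.
  - by split=> q x; exact: is_derive_cst.
  - by move=> h h0; split; exists 0 => q x; rewrite normr0 !mul0r.
have bj j : jet_function [set h | 0 < h] N (fun=> 0) (b j).
  have [t _ <-] := bB j; have /andP[t1 t2] := squash_range t.
  exists (fun q x => phi q (x + - squash t)), (fun _ _ => 0); split => //.
  - split => q x; last exact: is_derive_cst.
    exact: is_derive1_shift.
  - by move=> q; rewrite add0r phi_supp// normrN ger0_norm; lra.
  - move=> q x; rewrite ler_normr => x1; split => //; apply: phi_supp.
    by rewrite ler_normr; move: x1 => /orP[]; intros; apply/orP; [left|right]; lra.
  - move=> h h0; split; last by exists 0 => q x; rewrite normr0 !mul0r.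
    by have [D HD] := phi_bd h0; exists D => q x; exact: HD.
elim: n b c {bB} bj => [|n IH] b c bj; first by rewrite big_ord0.
rewrite big_ord_recl.
have := jet_function_linear (c ord0) (bj ord0) (IH _ (fun i => c (lift ord0 i)) (fun i => bj (lift ord0 i))).
by congr jet_function; apply/funext => q; rewrite mulr0 addr0.
Qed.

Lemma affine_family (H : set R) a f0 (P : set (R -> R[i]^o)) :
  H `<=` [set h | 0 < h] -> jet_function H N a f0 -> jet_function H N a `<=` P ->
  infinite_set P /\ exists2 A, A `<=` P & affine_space_of_dim [set: R] A.
Proof.
move=> H0 jf0 jP.
have jW w : linear_span bumps w -> P (f0 + w).
  move=> /jet_function_bumps[F [G [tFG wE j0 supp bd]]]; apply: jP.
  have jw : jet_function H N (fun=> 0) w.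
    by exists F, G; split => // h /H0; exact: bd.
  have := jet_function_linear 1 jf0 jw.
  rewrite scale1r; congr jet_function; apply/funext => q.
  by rewrite mul1r addr0.
split; last first.
  exists [set f0 + w | w in linear_span bumps]; first by move=> _ [w /jW Pw <-].
  exists f0, (linear_span bumps); split => //; first exact: span_subspace.
  by exists bumps; [split => //; exact: bumps_independent|exact: bumps_card].
pose u (n : nat) := f0 + translate (squash n%:R).
have u_inj : injective u.
  move=> m n /addrI/(@translate_inj m%:R n%:R)/eqP; rewrite eqr_nat => /eqP//.
apply: (@sub_infinite_set _ (range u)).
  move=> _ [n _ <-]; apply: jW.
  exists 1%N, (fun=> translate (squash n%:R)), (fun=> 1); split.
    by move=> _; exists n%:R.
  by rewrite big_ord1 scale1r.
have E : (range u #= [set: nat])%card by apply: inj_card_eq => s t _ _; exact: u_inj.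
move=> fin; apply: infinite_nat; move: fin; rewrite (eq_finite_set E)//.
Qed.

End Bump.
End FlatPerturbations.

(** * The extension theorem *)

(** The real and imaginary parts are extended with the same radii. *)
Lemma jet_realisation (R : realType) (N M lam : nat -> R) (A s Cm : R)
    (a : nat -> R[i]) (B : nat -> R) (C beta : R) :
  LC N -> (forall p, 0 < M p) -> (forall p, 0 < lam p) ->
  0 <= A -> 0 < s -> 1 <= Cm ->
  (forall p k, (p <= k)%N -> lam p <= N k.+1 / N k) ->
  (forall p n, \sum_(k < n) (N (p + k).+1 / N (p + k)%N)^-1 <= A * p.+1%:R / lam p) ->
  (forall p q, (q <= p)%N -> M p <= Cm * s ^+ p * N q * lam p ^+ (p - q)) ->
  let K := 5 * (1 + 2 * A) in
  radii M lam (fun p => Normc.normc (a p)) K (s * expR K) B C beta ->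
  exists f, jet_function [set h | 0 < h /\ small_from B h] N a f.
Proof.
move=> LN M_gt0 lam_gt0 A0 s0 Cm1 lam_nu tail MN K [B0 C0 rad na Bbeta].
have [N_gt0 N0 _ _] := LC_quotient LN.
have ext (alpha : nat -> R) : (forall p, `|alpha p| <= Normc.normc (a p)) ->
    exists F, [/\ tower F, forall q, F q 0 = alpha q,
      forall q x, 1 <= `|x| -> F q x = 0
      & forall h, 0 < h -> small_from B h -> bounded_by N h F].
  move=> ale; apply: (@real_extension R N M lam B alpha A s Cm C beta) => //.
  - exact: le_trans Cm1.
  - exact: ltW.
  - move=> p; apply: le_trans (na p); rewrite ler_wpM2r// exprn_ge0//.
    by rewrite !mulr_ge0 ?expR_ge0// ltW.
have [F [tF F0 Fs Fb]] := ext _ (fun p => normc_ge_Re (a p)).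
have [G [tG G0 Gs Gb]] := ext _ (fun p => normc_ge_Im (a p)).
exists (fun x => (F 0%N x +i* G 0%N x)%C), F, G; split => //.
- by move=> q; rewrite F0 G0; case: (a q).
- by move=> q x x1; rewrite Fs// Gs.
- by move=> h [h0 hB]; split; [exact: Fb|exact: Gb].
Qed.

(** Both cases at once: it remains to choose the radii, and to read the membership
    of the extensions in the Roumieu or Beurling space P. *)
Lemma affine_extension_family (R : realType) (M N : nat -> R) :
  LC N -> (forall p, 0 < M p) -> preceq M N -> SV M N ->
  exists (lam : nat -> R) (s Cm K L : R),
    [/\ forall p, 0 < lam p, 0 < s /\ 1 <= Cm, 0 < K /\ 0 < L,
      forall p, M p <= Cm * s ^+ p * lam p ^+ p
      & forall a B C beta,
        radii M lam (fun p => Normc.normc (a p)) K L B C beta ->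
        forall P : set (R -> R[i]^o),
        jet_function [set h | 0 < h /\ small_from B h] N a `<=` P ->
        infinite_set P /\
        exists2 A : set (R -> R[i]^o), A `<=` P & affine_space_of_dim [set: R] A].
Proof.
move=> LN M_gt0 pMN svMN; have [N_gt0 N0 _ nu_nd] := LC_quotient LN.
have [lam [A [s [Cm [lam_gt0 [A0 s0 Cm1] lam_nu tail MN]]]]] :=
  SV_data LN M_gt0 pMN svMN.
exists lam, s, Cm, (5 * (1 + 2 * A)), (s * expR (5 * (1 + 2 * A))); split => //.
- by split; [lra|rewrite mulr_gt0// expR_gt0].
- by move=> p; have := MN p 0%N (leq0n p); rewrite N0 mulr1 subn0.
- move=> a B C beta rB P jP.
  have N1 k : N 1%N <= N k.+1 / N k by have := nu_nd 0%N k isT; rewrite N0 divr1.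
  have r0 : 0 < 4^-1 :> R by rewrite invr_gt0.
  have [phi [tphi phi0 phis phib]] := bump_exists N_gt0 N0 N1 (tail 0%N) r0.
  have [f jf] := jet_realisation LN M_gt0 lam_gt0 A0 s0 Cm1 lam_nu tail MN rB.
  by apply: (affine_family tphi phi0 phis phib _ jf jP) => ? [].
Qed.

Theorem proposition5p2 (R : realType) (M N : nat -> R)
    (hN : LC N) (hSV : SV M N) :
  (NR N M -> forall a : nat -> R[i], Lambda_R M a ->
     infinite_set [set f | D_R N f /\ borel_map f = a] /\
     exists2 A : set (R -> R[i]^o),
       A `<=` [set f | D_R N f /\ borel_map f = a]
       & affine_space_of_dim [set: R] A) /\
  (NB N M -> forall a : nat -> R[i], Lambda_B M a ->
     infinite_set [set f | D_B N f /\ borel_map f = a] /\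
     exists2 A : set (R -> R[i]^o),
       A `<=` [set f | D_B N f /\ borel_map f = a]
       & affine_space_of_dim [set: R] A).
Proof.
have [N_gt0 _ _ _] := LC_quotient hN.
have n_ge0 (z : R[i]) : 0 <= Normc.normc z by case: z => x y; exact: sqrtr_ge0.
split=> [[M_gt0 liM pMN] a [h h0 ah]|[M_gt0 liM pMN] a ah];
    have [lam [s [Cm [K [L [lam_gt0 [s0 Cm1] [K0 L0] Mlam family]]]]]] :=
      affine_extension_family hN M_gt0 pMN hSV.
- have [C C0 HC] := Lambda_hP M_gt0 h0 ah.
  have [B [C' [beta rB]]] := radii_roumieu M_gt0 lam_gt0 s0 Cm1 K0 L0 Mlam
    (fun p => n_ge0 (a p)) liM (ex_intro2 _ _ h h0 (ex_intro2 _ _ C C0 HC)).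
  have [B0 _ _ _ Bb] := rB.
  have beta0 : 0 < beta by apply: lt_le_trans (Bb 0%N); rewrite divr_gt0.
  have Bbeta : small_from B beta by exists 0%N.
  apply: (family _ _ _ _ rB) => g jg.
  have [Dg bg] := jet_functionP N_gt0 jg (conj beta0 Bbeta) beta0.
  by split => //; exists beta.
- have [B [C' [beta [rB Bs]]]] := radii_beurling M_gt0 lam_gt0 s0 Cm1 K0 L0 Mlam
    (fun p => n_ge0 (a p)) liM (fun h h0 => Lambda_hP M_gt0 h0 (ah h h0)).
  apply: (family _ _ _ _ rB) => g jg.
  have D h (h0 : 0 < h) := jet_functionP N_gt0 jg (conj h0 (Bs h h0)) h0.
  by split => [h h0|]; [exact: (D h h0).1|exact: (D 1 ltr01).2].
Qed.
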